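(* (1) There exists a Markov trace $(t_n^{\dagger\dagger})$ on $(\widetilde{BMW}_n)_{n\ge1}$ with values in $S^{\dagger\dagger}$, given by $t_n^{\dagger\dagger}(\beta)=a^n\psi_n(\beta)$, where $\psi_n:\widetilde{BMW}_n\to S^{\dagger\dagger}$ is an $R$-algebra morphism defined by $s_i\mapsto a$. (2) Let $M$ be an $R$-module, $(t_n)$ a Markov trace on $(\widetilde{BMW}_n)$ with values in $M$, $N=M\otimes_R S^{\dagger\dagger}[(a-x)^{-1},(2a-x)^{-1}]$, and let $t'_3$ be the composite of $t_3$ with $M\to N$. Then $t'_3$ is a linear combination of $t_3^H$, $t_3^K$, $t_3^{\dagger\dagger}$ with coefficients in $N$: there exist $m_1,m_2,m_3\in N$ such that $t'_3(\beta)=t_3^H(\beta)m_1+t_3^K(\beta)m_2+t_3^{\dagger\dagger}(\beta)m_3$ for all $\beta\in\widetilde{BMW}_3$.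
   Context: $R=\mathbb{Q}[a,b,c,(abc)^{-1}]$, $x=b+c$, $y=bc$, $S=R[x^{-1}]$, $S_{\pm}=S/(a\mp y)$, $\overline{S}=S/(a^2-y^2)$, $S^{\dagger\dagger}=S/(a^2-1,y-1)=\overline{S}/(a^2-y)$. $H_n$ is the quotient of the group algebra $RB_n$ of the braid group (Artin generators $s_1,\dots,s_{n-1}$) by the relations $(s_i-a)(s_i-b)(s_i-c)=0$. $\widetilde{BMW}_n$ is the quotient of $H_n$ by the two-sided ideal generated by $$\mathcal{R}_i=-y\,s_is_{i+1}^{-1}s_i+y^2s_{i+1}^{-1}s_is_{i+1}^{-1}-s_is_{i+1}s_i-xy^2s_{i+1}^{-2}+x\,s_i^2+y^3s_{i+1}^{-1}s_i^{-1}s_{i+1}^{-1},\quad 1\le i\le n-2.$$ A Markov trace on a tower of algebras $(A_n)_{n\ge1}$ that are quotients of the group algebras of $B_n$, with values in a module $M$, is a sequence of linear maps $t_n:A_n\to M$ with $t_n(uv)=t_n(vu)$ and $t_{n+1}(\iota_n(u)s_n^{\pm1})=t_n(u)$ for all $u,v\in A_n$, where $\iota_n:A_n\to A_{n+1}$ is $s_i\mapsto s_i$. $t_n^H:\widetilde{BMW}_n\to S$ is the Ocneanu trace: the Markov trace with $t_1^H(1)=1$ factoring through $\mathcal{H}_n(b,c)=RB_n/((s_i-b)(s_i-c))$ (which is a quotient of $\widetilde{BMW}_n$); it classically exists and is unique. $BMW_n^{\pm}$ is the quotient of $H_n\otimes_R S_{\pm}$ by the two-sided ideal generated by $e_1s_2e_1-e_1$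 and $e_1s_2^{-1}e_1-e_1$ (no relation for $n\le2$), where $e_1=\frac{as_1^{-1}\pm s_1}{x}\mp1$; it is a quotient of $\widetilde{BMW}_n\otimes_R S_\pm$. The Kauffman trace $t_n^{\pm}:BMW_n^{\pm}\to S_{\pm}$ is the Markov trace given on braids by the Kauffman polynomial (original or Dubrovnik version) of the closure; it is the unique Markov trace on $(BMW_n^{\pm})$ with values in $S_\pm$ satisfying $t_1^{\pm}(1)=1$, $t_2^{\pm}(1)=\frac{y\mp x+1}{x}$. $t_n^K:\widetilde{BMW}_n\to\overline{S}$ is obtained from $(t_n^+,t_n^-)$ via $\overline{S}\simeq S_+\oplus S_-$. In the statement $t_3^H$ and $t_3^K$ are composed with $S\to S^{\dagger\dagger}$, $\overline S\to S^{\dagger\dagger}$. *)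

(* Defs.v *)
From HB Require Import structures.
From mathcomp Require Import all_boot all_algebra.
From mathcomp Require mpoly.
From mathcomp Require Import finmap boolp monalg.
From mathcomp Require Import ring.

Set Implicit Arguments.
Unset Strict Implicit.
Unset Printing Implicit Defensive.

Import GRing.Theory.

Local Open Scope quotient_scope.
Local Open Scope ring_scope.

(* Rings are pzRingType throughout (1 = 0 is allowed), so that quotients and
   localizations need no proof of non-triviality. *)

Inductive ideal (A : pzRingType) (P : A -> Prop) : A -> Prop :=
| ideal_gen z : P z -> ideal P z
| ideal0 : ideal P 0
| idealD u v : ideal P u -> ideal P v -> ideal P (u + v)
| idealMl u v : ideal P v -> ideal P (u * v)
| idealMr u v : ideal P u -> ideal P (u * v).

Definition ideal_pred (A : pzRingType) (P : A -> Prop) : {pred A} :=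
  fun z => `[< ideal P z >].

Section QuotRing.
Variables (A : pzRingType) (P : A -> Prop).

Lemma idealN u : ideal P u -> ideal P (- u).
Proof. by rewrite -mulN1r; exact: idealMl. Qed.

Fact ideal_zmod_closed : zmod_closed (ideal_pred P).
Proof.
split=> [|u v /asboolP iu /asboolP iv]; apply/asboolP; first exact: ideal0.
by apply: idealD => //; exact: idealN.
Qed.

HB.instance Definition _ :=
  GRing.isZmodClosed.Build A (ideal_pred P) ideal_zmod_closed.

Definition quotRing : Type := Quotient.quot (ideal_pred P).
HB.instance Definition _ := GRing.Zmodule.on quotRing.

Definition qproj (u : A) : quotRing := \pi_(Quotient.quot (ideal_pred P)) u.
Definition qrepr (u : quotRing) : A := repr (u : Quotient.quot (ideal_pred P)).

Lemma qreprK : cancel qrepr qproj.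
Proof. by move=> u; rewrite /qproj /qrepr reprK. Qed.

Lemma qproj_eq (u v : A) : ideal P (u - v) <-> qproj u = qproj v.
Proof.
split=> [h|/eqP]; first by apply/eqP; rewrite -Quotient.idealrBE; apply/asboolP.
by rewrite -Quotient.idealrBE => /asboolP.
Qed.

Lemma qprojK (u : A) : ideal P (qrepr (qproj u) - u).
Proof. by apply/qproj_eq; rewrite qreprK. Qed.

Lemma qproj_zmod_morphism : zmod_morphism qproj.
Proof. by move=> u v; rewrite /qproj !piE. Qed.
HB.instance Definition _ :=
  GRing.isZmodMorphism.Build A quotRing qproj qproj_zmod_morphism.

Definition qone : quotRing := qproj 1.
Definition qmul (u v : quotRing) : quotRing := qproj (qrepr u * qrepr v).

Lemma qprojM_subproof u v : qproj (u * v) = qmul (qproj u) (qproj v).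
Proof.
apply/esym/qproj_eq; set u' := qrepr _; set v' := qrepr _.
have -> : u' * v' - u * v = (u' - u) * v' + u * (v' - v).
  by rewrite mulrBl mulrBr addrA subrK.
by apply: idealD; [apply: idealMr | apply: idealMl]; exact: qprojK.
Qed.

Let qE := qprojM_subproof.

Fact qmulA : associative qmul.
Proof.
move=> u v w; rewrite -[u]qreprK -[v]qreprK -[w]qreprK.
by rewrite -!qE mulrA.
Qed.
Fact qmul1 : left_id qone qmul.
Proof. by move=> u; rewrite -[u]qreprK -!qE mul1r. Qed.
Fact qmulr1 : right_id qone qmul.
Proof. by move=> u; rewrite -[u]qreprK -!qE mulr1. Qed.
Fact qmulDl : left_distributive qmul +%R.
Proof.
move=> u v w; rewrite -[u]qreprK -[v]qreprK -[w]qreprK.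
by rewrite -raddfD -!qE -raddfD -mulrDl.
Qed.
Fact qmulDr : right_distributive qmul +%R.
Proof.
move=> u v w; rewrite -[u]qreprK -[v]qreprK -[w]qreprK.
by rewrite -raddfD -!qE -raddfD -mulrDr.
Qed.

HB.instance Definition _ := GRing.Zmodule_isPzRing.Build quotRing
  qmulA qmul1 qmulr1 qmulDl qmulDr.

Lemma qproj_monoid_morphism : monoid_morphism qproj.
Proof. by split=> // u v; exact: qprojM_subproof. Qed.
HB.instance Definition _ :=
  GRing.isMonoidMorphism.Build A quotRing qproj qproj_monoid_morphism.

End QuotRing.

Arguments qproj {A} P u.

Section QuotComRing.
Variables (A : comPzRingType) (P : A -> Prop).
Fact qmulC : commutative (@GRing.mul (quotRing P)).
Proof.
move=> u v; rewrite -[u]qreprK -[v]qreprK.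
by rewrite -!(rmorphM (qproj P)) mulrC.
Qed.
HB.instance Definition _ :=
  GRing.PzRing_hasCommutativeMul.Build (quotRing P) qmulC.
End QuotComRing.

Section QuotMap.
Variables (A B : pzRingType) (P : A -> Prop) (Q : B -> Prop).
Variable f : {rmorphism A -> B}.
Hypothesis fPQ : forall z, P z -> ideal Q (f z).

Definition qmap of (forall z, P z -> ideal Q (f z)) :=
  fun u : quotRing P => qproj Q (f (qrepr u)).

Lemma qmapE u : qmap fPQ (qproj P u) = qproj Q (f u).
Proof.
apply/qproj_eq; rewrite -rmorphB.
elim: (qprojK P u) => {u} [z Pz||u v _ iu _ iv|u v _ iv|u v _ iu].
- exact: fPQ.
- by rewrite rmorph0; exact: ideal0.
- by rewrite rmorphD; exact: idealD.
- by rewrite rmorphM; exact: idealMl.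
- by rewrite rmorphM; exact: idealMr.
Qed.

Fact qmap_zmod_morphism : zmod_morphism (qmap fPQ).
Proof.
move=> u v; rewrite -[u]qreprK -[v]qreprK -(rmorphB (qproj P)).
by rewrite !qmapE !rmorphB.
Qed.
Fact qmap_monoid_morphism : monoid_morphism (qmap fPQ).
Proof.
split=> [|u v]; first by rewrite -(rmorph1 (qproj P)) qmapE !rmorph1.
rewrite -[u]qreprK -[v]qreprK -(rmorphM (qproj P)).
by rewrite !qmapE !rmorphM.
Qed.
HB.instance Definition _ := GRing.isZmodMorphism.Build _ _ (qmap fPQ)
  qmap_zmod_morphism.
HB.instance Definition _ := GRing.isMonoidMorphism.Build _ _ (qmap fPQ)
  qmap_monoid_morphism.
End QuotMap.

Section Localization.
Variables (K : comPzRingType) (f : K).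

(* (u, m) stands for u / f ^+ m *)
Definition loc_rel (p q : K * nat) : bool :=
  `[< exists k, p.1 * f ^+ (q.2 + k) = q.1 * f ^+ (p.2 + k) >].

Lemma loc_rel_equiv : equiv_class_of loc_rel.
Proof.
have sym p q : loc_rel p q -> loc_rel q p.
  by move=> /asboolP[k e]; apply/asboolP; exists k.
split=> [p|p q|q p r /asboolP[k e1] /asboolP[l e2]].
- by apply/asboolP; exists 0%N.
- by apply/idP/idP; exact: sym.
apply/asboolP; exists (q.2 + k + l)%N; move: e1 e2; rewrite !exprD => e1 e2.
transitivity ((p.1 * (f ^+ q.2 * f ^+ k)) * (f ^+ r.2 * f ^+ l)).
  by ring.
rewrite e1; transitivity ((q.1 * (f ^+ r.2 * f ^+ l)) * (f ^+ p.2 * f ^+ k)).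
  by ring.
by rewrite e2; ring.
Qed.

Canonical loc_rel_equiv_rel := EquivRelPack loc_rel_equiv.
Canonical loc_rel_encModRel := defaultEncModRel loc_rel.

Definition loc : Type := {eq_quot loc_rel}.
HB.instance Definition _ := Choice.on loc.

Definition frac (u : K) (m : nat) : loc := \pi_{eq_quot loc_rel} (u, m).

Lemma fracP (u v : K) m n :
  (exists k, u * f ^+ (n + k) = v * f ^+ (m + k)) <-> frac u m = frac v n.
Proof. by split=> [h|/eqmodP/asboolP//]; apply/eqmodP/asboolP. Qed.

Lemma locW (T : loc -> Prop) : (forall u m, T (frac u m)) -> forall z, T z.
Proof. by move=> h z; rewrite -[z](@reprK _ {eq_quot loc_rel}); case: repr. Qed.

Definition num (z : loc) : K := (repr (z : {eq_quot loc_rel})).1.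
Definition den (z : loc) : nat := (repr (z : {eq_quot loc_rel})).2.

Lemma frac_numden z : frac (num z) (den z) = z.
Proof.
rewrite /frac /num /den -surjective_pairing.
exact: (@reprK _ {eq_quot loc_rel}).
Qed.

Definition loc_add (z t : loc) : loc :=
  frac (num z * f ^+ den t + num t * f ^+ den z) (den z + den t).
Definition loc_opp (z : loc) : loc := frac (- num z) (den z).
Definition loc_mul (z t : loc) : loc := frac (num z * num t) (den z + den t).

Lemma loc_addE u m v n :
  loc_add (frac u m) (frac v n) = frac (u * f ^+ n + v * f ^+ m) (m + n).
Proof.
rewrite /loc_add.
have /fracP := frac_numden (frac u m); move: (num _) (den _) => u' m' [k e1].
have /fracP := frac_numden (frac v n); move: (num _) (den _) => v' n' [l e2].
apply/fracP; exists (k + l)%N; move: e1 e2; rewrite !exprD => e1 e2.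
transitivity ((u' * (f ^+ m * f ^+ k)) * (f ^+ n' * f ^+ n * f ^+ l)
   + (v' * (f ^+ n * f ^+ l)) * (f ^+ m' * f ^+ m * f ^+ k)); first by ring.
by rewrite e1 e2; ring.
Qed.

Lemma loc_oppE u m : loc_opp (frac u m) = frac (- u) m.
Proof.
rewrite /loc_opp; have /fracP[k e] := frac_numden (frac u m).
by apply/fracP; exists k; rewrite !mulNr e.
Qed.

Lemma loc_mulE u m v n : loc_mul (frac u m) (frac v n) = frac (u * v) (m + n).
Proof.
rewrite /loc_mul.
have /fracP := frac_numden (frac u m); move: (num _) (den _) => u' m' [k e1].
have /fracP := frac_numden (frac v n); move: (num _) (den _) => v' n' [l e2].
apply/fracP; exists (k + l)%N; move: e1 e2; rewrite !exprD => e1 e2.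
transitivity ((u' * (f ^+ m * f ^+ k)) * (v' * (f ^+ n * f ^+ l))).
  by ring.
by rewrite e1 e2; ring.
Qed.

Let locE := (loc_addE, loc_oppE, loc_mulE).

Fact loc_addA : associative loc_add.
Proof.
elim/locW=> u m; elim/locW=> v n; elim/locW=> w p; rewrite !locE.
by apply/fracP; exists 0%N; rewrite !exprD; ring.
Qed.
Fact loc_addC : commutative loc_add.
Proof.
elim/locW=> u m; elim/locW=> v n; rewrite !locE.
by apply/fracP; exists 0%N; rewrite !exprD; ring.
Qed.
Fact loc_add0 : left_id (frac 0 0) loc_add.
Proof.
elim/locW=> u m; rewrite !locE.
by apply/fracP; exists 0%N; rewrite !exprD; ring.
Qed.
Fact loc_addN : left_inverse (frac 0 0) loc_opp loc_add.
Proof.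
elim/locW=> u m; rewrite !locE.
by apply/fracP; exists 0%N; rewrite !exprD; ring.
Qed.
HB.instance Definition _ := GRing.isZmodule.Build loc
  loc_addA loc_addC loc_add0 loc_addN.

Fact loc_mulA : associative loc_mul.
Proof.
elim/locW=> u m; elim/locW=> v n; elim/locW=> w p; rewrite !locE.
by rewrite mulrA addnA.
Qed.
Fact loc_mulC : commutative loc_mul.
Proof. by elim/locW=> u m; elim/locW=> v n; rewrite !locE mulrC addnC. Qed.
Fact loc_mul1 : left_id (frac 1 0) loc_mul.
Proof. by elim/locW=> u m; rewrite !locE mul1r. Qed.
Fact loc_mulDl : left_distributive loc_mul +%R.
Proof.
elim/locW=> u m; elim/locW=> v n; elim/locW=> w p.
rewrite [in LHS]/GRing.add [in RHS]/GRing.add /= !locE.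
by apply/fracP; exists 0%N; rewrite !exprD; ring.
Qed.
HB.instance Definition _ := GRing.Zmodule_isComPzRing.Build loc
  loc_mulA loc_mulC loc_mul1 loc_mulDl.

Definition locin (u : K) : loc := frac u 0.
Definition locinv : loc := frac 1 1.

Lemma fracD u m v n :
  frac u m + frac v n = frac (u * f ^+ n + v * f ^+ m) (m + n).
Proof. exact: loc_addE. Qed.
Lemma fracN u m : - frac u m = frac (- u) m.
Proof. exact: loc_oppE. Qed.
Lemma fracM u m v n : frac u m * frac v n = frac (u * v) (m + n).
Proof. exact: loc_mulE. Qed.

Fact locin_zmod_morphism : zmod_morphism locin.
Proof. by move=> u v; rewrite /locin fracN fracD !expr0 !mulr1. Qed.
Fact locin_monoid_morphism : monoid_morphism locin.
Proof. by split=> // u v; rewrite /locin fracM. Qed.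
HB.instance Definition _ :=
  GRing.isZmodMorphism.Build K loc locin locin_zmod_morphism.
HB.instance Definition _ :=
  GRing.isMonoidMorphism.Build K loc locin locin_monoid_morphism.

Lemma locin_inv : locin f * locinv = 1.
Proof.
rewrite /locin /locinv fracM; apply/fracP; exists 0%N.
by rewrite !exprD; ring.
Qed.

End Localization.

Arguments locin {K} f u.
Arguments locinv {K} f.

(* monalg only equips {malg K[X]} with a scaling when 1 != 0 in K *)
Definition freemod (K : pzRingType) (X : choiceType) : Type := {malg K[X]}.

Section FreeModule.
Variables (K : pzRingType) (X : choiceType).
HB.instance Definition _ := GRing.Zmodule.on (freemod K X).

Definition fm_scale (k : K) (g : freemod K X) : freemod K X :=
  \sum_(i <- msupp g) << k * g@_i *g i >>.

Lemma fm_scaleE k g i : (fm_scale k g)@_i = k * g@_i.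
Proof.
rewrite {2}[g]monalgE !raddf_sum mulr_sumr.
by apply/eq_bigr=> /= j _; rewrite !mcoeffU mulrnAr.
Qed.

Fact fm_scaleA k l g : fm_scale k (fm_scale l g) = fm_scale (k * l) g.
Proof. by apply/malgP=> i; rewrite !fm_scaleE mulrA. Qed.
Fact fm_scale1 : left_id 1 fm_scale.
Proof. by move=> g; apply/malgP=> i; rewrite fm_scaleE mul1r. Qed.
Fact fm_scaleDr : right_distributive fm_scale +%R.
Proof.
by move=> k g h; apply/malgP=> i; rewrite !(mcoeffD, fm_scaleE) mulrDr.
Qed.
Fact fm_scaleDl g : {morph fm_scale^~ g : k l / k + l}.
Proof.
by move=> k l; apply/malgP=> i; rewrite !(mcoeffD, fm_scaleE) mulrDl.
Qed.
HB.instance Definition _ := GRing.Zmodule_isLmodule.Build K (freemod K X)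
  fm_scaleA fm_scale1 fm_scaleDr fm_scaleDl.

Definition fm_gen (i : X) : freemod K X := << i >>.
End FreeModule.

Arguments fm_gen K {X} i.

Inductive submod (K : pzRingType) (V : lmodType K) (P : V -> Prop) :
    V -> Prop :=
| submod_gen z : P z -> submod P z
| submod0 : submod P 0
| submodD u v : submod P u -> submod P v -> submod P (u + v)
| submodZ k v : submod P v -> submod P (k *: v).

Definition submod_pred (K : pzRingType) (V : lmodType K) (P : V -> Prop) :
  {pred V} := fun z => `[< submod P z >].

Section QuotMod.
Variables (K : pzRingType) (V : lmodType K) (P : V -> Prop).

Fact submod_zmod_closed : zmod_closed (submod_pred P).
Proof.
split=> [|u v /asboolP iu /asboolP iv]; apply/asboolP; first exact: submod0.
by rewrite -scaleN1r; apply: submodD => //; exact: submodZ.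
Qed.
HB.instance Definition _ :=
  GRing.isZmodClosed.Build V (submod_pred P) submod_zmod_closed.

Definition quotMod : Type := Quotient.quot (submod_pred P).
HB.instance Definition _ := GRing.Zmodule.on quotMod.

Definition mproj (u : V) : quotMod := \pi_(Quotient.quot (submod_pred P)) u.
Definition mrepr (u : quotMod) : V := repr (u : Quotient.quot (submod_pred P)).

Lemma mreprK : cancel mrepr mproj.
Proof. by move=> u; rewrite /mproj /mrepr reprK. Qed.

Lemma mproj_eq (u v : V) : submod P (u - v) <-> mproj u = mproj v.
Proof.
split=> [h|/eqP]; first by apply/eqP; rewrite -Quotient.idealrBE; apply/asboolP.
by rewrite -Quotient.idealrBE => /asboolP.
Qed.

Lemma mproj_zmod_morphism : zmod_morphism mproj.
Proof. by move=> u v; rewrite /mproj !piE. Qed.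
HB.instance Definition _ :=
  GRing.isZmodMorphism.Build V quotMod mproj mproj_zmod_morphism.

Definition mscale (k : K) (u : quotMod) : quotMod := mproj (k *: mrepr u).

Lemma mscaleE k u : mscale k (mproj u) = mproj (k *: u).
Proof.
by apply/mproj_eq; rewrite -scalerBr; apply/submodZ/mproj_eq; rewrite mreprK.
Qed.

Fact mscaleA k l u : mscale k (mscale l u) = mscale (k * l) u.
Proof. by rewrite -[u]mreprK !mscaleE scalerA. Qed.
Fact mscale1 : left_id 1 mscale.
Proof. by move=> u; rewrite -[u]mreprK mscaleE scale1r. Qed.
Fact mscaleDr : right_distributive mscale +%R.
Proof.
move=> k u v; rewrite -[u]mreprK -[v]mreprK -raddfD !mscaleE.
by rewrite -raddfD scalerDr.
Qed.
Fact mscaleDl u : {morph mscale^~ u : k l / k + l}.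
Proof. by move=> k l; rewrite -[u]mreprK !mscaleE -raddfD scalerDl. Qed.
HB.instance Definition _ := GRing.Zmodule_isLmodule.Build K quotMod
  mscaleA mscale1 mscaleDr mscaleDl.

Fact mproj_scalable : scalable mproj.
Proof. by move=> k u; rewrite -mscaleE. Qed.
HB.instance Definition _ :=
  GRing.isScalable.Build K V quotMod *:%R mproj mproj_scalable.

End QuotMod.

Arguments mproj {K V} P u.

Section Scalars.
Variables (K L : comPzRingType) (rho : {rmorphism K -> L}).

(* L as a K-module through rho *)
Definition restr of {rmorphism K -> L} : Type := L.
HB.instance Definition _ := GRing.ComPzRing.on (restr rho).

Definition restr_scale (k : K) (v : restr rho) : restr rho := rho k * v.
Fact restr_scaleA k l v :
  restr_scale k (restr_scale l v) = restr_scale (k * l) v.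
Proof. by rewrite /restr_scale rmorphM mulrA. Qed.
Fact restr_scale1 : left_id 1 restr_scale.
Proof. by move=> v; rewrite /restr_scale rmorph1 mul1r. Qed.
Fact restr_scaleDr : right_distributive restr_scale +%R.
Proof. by move=> k u v; rewrite /restr_scale mulrDr. Qed.
Fact restr_scaleDl v : {morph restr_scale^~ v : k l / k + l}.
Proof. by move=> k l; rewrite /restr_scale rmorphD mulrDl. Qed.
HB.instance Definition _ := GRing.Zmodule_isLmodule.Build K (restr rho)
  restr_scaleA restr_scale1 restr_scaleDr restr_scaleDl.

Variable M : lmodType K.

(* M (x)_K L as an L-module: generators m (x) 1 for m in M, subject to
   K-linearity in m; then m (x) l = l *: (m (x) 1). *)
Inductive ext_relator : freemod L M -> Prop :=
| ext_relD m n :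
    ext_relator (fm_gen L (m + n) - (fm_gen L m + fm_gen L n))
| ext_relZ k m :
    ext_relator (fm_gen L (k *: m) - rho k *: fm_gen L m).

Definition extmod : lmodType L := quotMod ext_relator.
Definition ext_in (m : M) : extmod := mproj ext_relator (fm_gen L m).

End Scalars.

Definition grpalg (K : comPzRingType) (G : groupType) : Type := {malg K[G]}.

(* k x, for k in K and x in G; locked to keep unification from unfolding it *)
HB.lock Definition ga_mono (K : comPzRingType) (G : groupType) (k : K) (x : G) :
  grpalg K G := << k *g x >>.

Section GroupAlgebra.
Variables (K : comPzRingType) (G : groupType).
HB.instance Definition _ := GRing.Zmodule.on (grpalg K G).
Implicit Types g h : grpalg K G.

Definition ga_gen (x : G) : grpalg K G := ga_mono 1 x.
Definition ga_one : grpalg K G := ga_mono 1 1%g.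
Definition ga_mul g h : grpalg K G :=
  \sum_(x <- msupp g) \sum_(y <- msupp h) << g@_x * h@_y *g (x * y)%g >>.

Lemma ga_mulw (d1 d2 : {fset G}) g h :
  (msupp g `<=` d1)%fset -> (msupp h `<=` d2)%fset ->
  ga_mul g h = \sum_(x <- d1) \sum_(y <- d2) << g@_x * h@_y *g (x * y)%g >>.
Proof.
move=> le1 le2; rewrite /ga_mul (big_fset_incl _ le1) /=.
  apply/eq_bigr=> x _; apply/big_fset_incl => // y _ /mcoeff_outdom ->.
  by rewrite mulr0 monalgU0.
move=> x _ /mcoeff_outdom gx.
by rewrite big1 => // y _; rewrite gx mul0r monalgU0.
Qed.

Fact ga_mulDl : left_distributive ga_mul +%R.
Proof.
move=> g1 g2 h; pose d := (msupp g1 `|` msupp g2)%fset.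
rewrite (@ga_mulw d (msupp h) g1) ?fsubsetUl //.
rewrite (@ga_mulw d (msupp h) g2) ?fsubsetUr //.
rewrite (@ga_mulw d (msupp h)) ?msuppD_le // -big_split; apply: eq_bigr => x _.
rewrite -big_split; apply: eq_bigr => y _ /=.
by rewrite mcoeffD mulrDl monalgUD.
Qed.

Fact ga_mulDr : right_distributive ga_mul +%R.
Proof.
move=> h g1 g2; pose d := (msupp g1 `|` msupp g2)%fset.
rewrite (@ga_mulw (msupp h) d h g1) ?fsubsetUl //.
rewrite (@ga_mulw (msupp h) d h g2) ?fsubsetUr //.
rewrite (@ga_mulw (msupp h) d) ?msuppD_le // -big_split; apply: eq_bigr => x _.
rewrite -big_split; apply: eq_bigr => y _ /=.
by rewrite mcoeffD mulrDr monalgUD.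
Qed.

Lemma ga_mul0l h : ga_mul 0 h = 0.
Proof. by rewrite /ga_mul msupp0 big_seq_fset0. Qed.
Lemma ga_mul0r h : ga_mul h 0 = 0.
Proof. by rewrite /ga_mul big1 // => x _; rewrite msupp0 big_seq_fset0. Qed.

Lemma ga_mulUU k l x y :
  ga_mul << k *g x >> << l *g y >> = << k * l *g (x * y)%g >>.
Proof. by rewrite (ga_mulw msuppU_le msuppU_le) !big_seq_fset1 !mcoeffUU. Qed.

Lemma ga_ind (T : grpalg K G -> Prop) :
  T 0 -> (forall g h, T g -> T h -> T (g + h)) ->
  (forall k x, T << k *g x >>) -> forall g, T g.
Proof. by move=> T0 TD TU g; rewrite [g]monalgE; exact: (big_ind T). Qed.

Fact ga_mulA : associative ga_mul.
Proof.
elim/ga_ind=> [|g1 g2 IH1 IH2|k x] h1 h2.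
- by rewrite !ga_mul0l.
- by rewrite !ga_mulDl IH1 IH2.
elim/ga_ind: h1 => [|g1 g2 IH1 IH2|l y].
- by rewrite !(ga_mul0l, ga_mul0r).
- by rewrite !(ga_mulDl, ga_mulDr) IH1 IH2.
elim/ga_ind: h2 => [|g1 g2 IH1 IH2|m z].
- by rewrite !(ga_mul0l, ga_mul0r).
- by rewrite !(ga_mulDl, ga_mulDr) IH1 IH2.
by rewrite !ga_mulUU mulrA mulgA.
Qed.

Fact ga_mul1 : left_id ga_one ga_mul.
Proof.
rewrite /ga_one ga_mono.unlock.
elim/ga_ind=> [|g1 g2 IH1 IH2|k x]; rewrite ?ga_mul0r ?ga_mulDr ?IH1 ?IH2 //.
by rewrite ga_mulUU mul1r mul1g.
Qed.
Fact ga_mulr1 : right_id ga_one ga_mul.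
Proof.
rewrite /ga_one ga_mono.unlock.
elim/ga_ind=> [|g1 g2 IH1 IH2|k x]; rewrite ?ga_mul0l ?ga_mulDl ?IH1 ?IH2 //.
by rewrite ga_mulUU mulr1 mulg1.
Qed.

HB.instance Definition _ := GRing.Zmodule_isPzRing.Build (grpalg K G)
  ga_mulA ga_mul1 ga_mulr1 ga_mulDl ga_mulDr.

Lemma ga_monoM k l x y : ga_mono k x * ga_mono l y = ga_mono (k * l) (x * y)%g.
Proof. by rewrite ga_mono.unlock; exact: ga_mulUU. Qed.

Definition ga_cst (k : K) : grpalg K G := ga_mono k 1%g.

Fact ga_cst_zmod_morphism : zmod_morphism ga_cst.
Proof. by move=> k l; rewrite /ga_cst ga_mono.unlock monalgUB. Qed.
Fact ga_cst_monoid_morphism : monoid_morphism ga_cst.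
Proof. by split=> // k l; rewrite /ga_cst ga_monoM mulg1. Qed.
HB.instance Definition _ :=
  GRing.isZmodMorphism.Build K (grpalg K G) ga_cst ga_cst_zmod_morphism.
HB.instance Definition _ :=
  GRing.isMonoidMorphism.Build K (grpalg K G) ga_cst ga_cst_monoid_morphism.

End GroupAlgebra.

Arguments ga_gen K {G} x.
Arguments ga_cst {K} G k.

Section GroupAlgebraMap.
Variables (K L : comPzRingType) (G H : groupType).
Variables (rho : {rmorphism K -> L}) (f : UMagmaMorphism.type G H).

(* K[G] -> L[H], k x |-> rho(k) f(x) *)
Definition ga_map (g : grpalg K G) : grpalg L H :=
  \sum_(x <- msupp g) << rho g@_x *g f x >>.

Lemma ga_mapw (d : {fset G}) g : (msupp g `<=` d)%fset ->
  ga_map g = \sum_(x <- d) << rho g@_x *g f x >>.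
Proof.
move=> le; apply/big_fset_incl => // x _ /mcoeff_outdom ->.
by rewrite rmorph0 monalgU0.
Qed.

Lemma ga_mapU k x : ga_map << k *g x >> = << rho k *g f x >>.
Proof. by rewrite (ga_mapw msuppU_le) big_seq_fset1 mcoeffUU. Qed.

Lemma ga_map_mono k x : ga_map (ga_mono k x) = ga_mono (rho k) (f x).
Proof. by rewrite !ga_mono.unlock ga_mapU. Qed.

Lemma ga_mapD : {morph ga_map : g h / g + h}.
Proof.
move=> g h; pose d := (msupp g `|` msupp h)%fset.
rewrite (@ga_mapw d g) ?fsubsetUl // (@ga_mapw d h) ?fsubsetUr //.
rewrite (@ga_mapw d) ?msuppD_le // -big_split; apply: eq_bigr => x _ /=.
by rewrite mcoeffD rmorphD monalgUD.
Qed.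

Lemma ga_map0 : ga_map 0 = 0.
Proof. by rewrite /ga_map msupp0 big_seq_fset0. Qed.

Lemma ga_mapN g : ga_map (- g) = - ga_map g.
Proof. by apply/eqP; rewrite -addr_eq0 -ga_mapD addNr ga_map0. Qed.

Fact ga_map_zmod_morphism : zmod_morphism ga_map.
Proof. by move=> g h; rewrite ga_mapD ga_mapN. Qed.

Fact ga_map_monoid_morphism : monoid_morphism ga_map.
Proof.
split=> [|g h]; first by rewrite [LHS]ga_map_mono rmorph1 gmulf1.
elim/ga_ind: g => [|g1 g2 IH1 IH2|k x].
- by rewrite mul0r ga_map0 mul0r.
- by rewrite mulrDl !ga_mapD mulrDl IH1 IH2.
elim/ga_ind: h => [|g1 g2 IH1 IH2|l y].
- by rewrite mulr0 ga_map0 mulr0.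
- by rewrite mulrDr !ga_mapD mulrDr IH1 IH2.
by rewrite [in LHS]/GRing.mul /= ga_mulUU !ga_mapU [RHS]ga_mulUU rmorphM gmulfM.
Qed.

HB.instance Definition _ :=
  GRing.isZmodMorphism.Build _ _ ga_map ga_map_zmod_morphism.
HB.instance Definition _ :=
  GRing.isMonoidMorphism.Build _ _ ga_map ga_map_monoid_morphism.
End GroupAlgebraMap.

(* The letter (i, true), 0 <= i < n - 1, is the Artin generator s_(i+1), and
   (i, false) is its inverse; there are no letters for n <= 1. *)
Definition braid_word (n : nat) : Type := seq ('I_n.-1 * bool).
HB.instance Definition _ n := Choice.on (braid_word n).

Inductive braid_eqv (n : nat) : braid_word n -> braid_word n -> Prop :=
| be_refl u : braid_eqv u u
| be_sym u v : braid_eqv u v -> braid_eqv v u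
| be_trans u v w : braid_eqv u v -> braid_eqv v w -> braid_eqv u w
| be_cat u u' v v' :
    braid_eqv u u' -> braid_eqv v v' -> braid_eqv (u ++ v) (u' ++ v')
| be_inv i e : braid_eqv [:: (i, e); (i, ~~ e)] [::]
| be_comm (i j : 'I_n.-1) : (i.+1 < j)%N ->
    braid_eqv [:: (i, true); (j, true)] [:: (j, true); (i, true)]
| be_braid (i j : 'I_n.-1) : j = i.+1 :> nat ->
    braid_eqv [:: (i, true); (j, true); (i, true)]
              [:: (j, true); (i, true); (j, true)].

Definition braid_rel n : rel (braid_word n) := fun u v => `[< braid_eqv u v >].

Lemma braid_rel_equiv n : equiv_class_of (@braid_rel n).
Proof.
split=> [u|u v|v u w /asboolP e1 /asboolP e2].
- by apply/asboolP; exact: be_refl.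
- by apply/asboolP/asboolP; exact: be_sym.
- by apply/asboolP; exact: be_trans e2.
Qed.
Canonical braid_rel_equiv_rel n := EquivRelPack (@braid_rel_equiv n).
Canonical braid_rel_encModRel n := defaultEncModRel (@braid_rel n).

Definition braid (n : nat) : Type := {eq_quot @braid_rel n}.

Section BraidGroup.
Variable n : nat.
HB.instance Definition _ := Choice.on (braid n).
Implicit Types u v w : braid_word n.

Definition bclass u : braid n := \pi_{eq_quot @braid_rel n} u.
Definition bword (x : braid n) : braid_word n :=
  repr (x : {eq_quot @braid_rel n}).

Lemma bwordK : cancel bword bclass.
Proof. by move=> x; rewrite /bclass /bword reprK. Qed.

Lemma bclassP u v : braid_eqv u v <-> bclass u = bclass v.
Proof. by split=> [h|/eqmodP/asboolP//]; apply/eqmodP/asboolP. Qed.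

Lemma bclassK u : braid_eqv (bword (bclass u)) u.
Proof. by apply/bclassP; rewrite bwordK. Qed.

Definition winv u : braid_word n := rev [seq (p.1, ~~ p.2) | p <- u].

Lemma winv_cat u v : winv (u ++ v) = winv v ++ winv u.
Proof. by rewrite /winv map_cat rev_cat. Qed.

Lemma winvK : involutive winv.
Proof.
move=> u; rewrite /winv map_rev revK -map_comp -[RHS]map_id.
by apply: eq_map => -[i e] /=; rewrite negbK.
Qed.

Lemma winvr u : braid_eqv (u ++ winv u) [::].
Proof.
elim: u => [|[i e] u IH]; first exact: be_refl.
have -> : ((i, e) :: u) ++ winv ((i, e) :: u) =
    ([:: (i, e)] ++ (u ++ winv u)) ++ [:: (i, ~~ e)].
  by rewrite /winv /= rev_cons -cats1 catA.
apply: be_trans (be_inv i e).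
apply: (@be_cat _ _ ([:: (i, e)] ++ [::])); last exact: be_refl.
by apply: be_cat IH; exact: be_refl.
Qed.

Lemma winvl u : braid_eqv (winv u ++ u) [::].
Proof. by rewrite -{2}[u]winvK; exact: winvr. Qed.

Lemma winv_eqv u v : braid_eqv u v -> braid_eqv (winv u) (winv v).
Proof.
move=> e; have h : braid_eqv (winv u ++ v ++ winv v) (winv v).
  rewrite catA -[X in braid_eqv _ X]cat0s; apply: be_cat (be_refl _).
  apply: be_trans (winvl u); apply: be_cat (be_refl _) _; exact: be_sym.
apply: be_trans h; apply: be_sym; rewrite -[X in braid_eqv _ X]cats0.
by apply: be_cat (be_refl _) _; exact: winvr.
Qed.

Definition bone : braid n := bclass [::].
Definition bmul (x y : braid n) : braid n := bclass (bword x ++ bword y).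
Definition binv (x : braid n) : braid n := bclass (winv (bword x)).

Lemma bmulE u v : bmul (bclass u) (bclass v) = bclass (u ++ v).
Proof. by apply/bclassP; apply: be_cat; exact: bclassK. Qed.
Lemma binvE u : binv (bclass u) = bclass (winv u).
Proof. by apply/bclassP/winv_eqv; exact: bclassK. Qed.

Fact bmulA : associative bmul.
Proof.
move=> x y z; rewrite -[x]bwordK -[y]bwordK -[z]bwordK.
by rewrite !bmulE catA.
Qed.
Fact bmul1 : left_id bone bmul.
Proof. by move=> x; rewrite -[x]bwordK bmulE. Qed.
Fact bmulr1 : right_id bone bmul.
Proof. by move=> x; rewrite -[x]bwordK bmulE cats0. Qed.
Fact bmulV : left_inverse bone binv bmul.
Proof. by move=> x; rewrite -[x]bwordK binvE bmulE; apply/bclassP/winvl. Qed.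
Fact bmulVr : right_inverse bone binv bmul.
Proof. by move=> x; rewrite -[x]bwordK binvE bmulE; apply/bclassP/winvr. Qed.

HB.instance Definition _ := isGroup.Build (braid n)
  bmulA bmul1 bmulr1 bmulV bmulVr.

Definition sigma (i : 'I_n.-1) : braid n := bclass [:: (i, true)].

End BraidGroup.

Section BraidInclusion.
Variable n : nat.

Definition wincl (u : braid_word n) : braid_word n.+1 :=
  [seq (widen_ord (leq_pred n) p.1, p.2) | p <- u].

(* iota_n : B_n -> B_(n+1), s_i |-> s_i *)
Definition bincl (x : braid n) : braid n.+1 := bclass (wincl (bword x)).

Lemma wincl_eqv u v : braid_eqv u v -> braid_eqv (wincl u) (wincl v).
Proof.
elim=> {u v}.
- by move=> u; exact: be_refl.
- by move=> u v _; exact: be_sym.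
- by move=> u v w _ h1 _; exact: be_trans h1.
- by move=> u u' v v' _ h1 _ h2; rewrite /wincl !map_cat; exact: be_cat.
- by move=> i e; exact: be_inv.
- by move=> i j ij; exact: be_comm.
- by move=> i j ij; exact: be_braid.
Qed.

Lemma binclE u : bincl (bclass u) = bclass (wincl u).
Proof. by apply/bclassP/wincl_eqv; exact: bclassK. Qed.

Fact bincl_monoid_morphism : monoid.monoid_morphism bincl.
Proof.
split=> [|x y]; first exact: binclE.
rewrite -[x]bwordK -[y]bwordK [in LHS]/monoid.mul /= bmulE !binclE.
by rewrite /wincl map_cat -bmulE.
Qed.
HB.instance Definition _ :=
  isUMagmaMorphism.Build (braid n) (braid n.+1) bincl
    bincl_monoid_morphism.
End BraidInclusion.

(* Algebras A_n, each a quotient of the group algebra K B_n, with compatible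
   maps iota_n : A_n -> A_(n+1), s_i |-> s_i. Only n >= 1 matters: a Markov
   trace is unconstrained at n = 0. *)
Record tower (K : comPzRingType) := Tower {
  tw_alg :> nat -> pzRingType;
  tw_pi : forall n, {rmorphism grpalg K (braid n) -> tw_alg n};
  tw_surj : forall n (u : tw_alg n), exists h, tw_pi n h = u;
  tw_incl : forall n, {rmorphism tw_alg n -> tw_alg n.+1};
  tw_inclE : forall n h,
    tw_incl n (tw_pi n h) = tw_pi n.+1 (ga_map idfun (@bincl n) h)
}.

Section Tower.
Variables (K : comPzRingType) (A : tower K).

(* the structure morphism K -> A_n; linearity over K is expressed through it *)
Definition tw_cst n : {rmorphism K -> A n} := tw_pi A n \o ga_cst (braid n).
Definition tw_s n (i : 'I_n.-1) : A n := tw_pi A n (ga_gen K (sigma i)).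
Definition tw_sV n (i : 'I_n.-1) : A n := tw_pi A n (ga_gen K (sigma i)^-1%g).

Lemma tw_incl_cst n k : tw_incl A n (tw_cst n k) = tw_cst n.+1 k.
Proof. by rewrite tw_inclE ga_map_mono gmulf1. Qed.

Lemma bincl_sigma n (i : 'I_n.-1) :
  bincl (sigma i) = sigma (widen_ord (leq_pred n) i : 'I_n.+1.-1).
Proof. exact: binclE. Qed.

Lemma tw_incl_s n (i : 'I_n.-1) :
  tw_incl A n (tw_s i) = @tw_s n.+1 (widen_ord (leq_pred n) i).
Proof.
by rewrite tw_inclE ga_map_mono rmorph1 [X in ga_mono _ X]bincl_sigma.
Qed.

Lemma tw_incl_sV n (i : 'I_n.-1) :
  tw_incl A n (tw_sV i) = @tw_sV n.+1 (widen_ord (leq_pred n) i).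
Proof.
rewrite tw_inclE ga_map_mono rmorph1; congr (tw_pi A n.+1 (ga_mono 1 _)).
by rewrite [(sigma i)^-1%g]binvE [LHS]binclE [RHS]binvE.
Qed.

Record markov_trace (M : lmodType K) (t : forall n, A n -> M) : Prop := {
  mt_linear : forall n k (u v : A n.+1),
    t n.+1 (tw_cst _ k * u + v) = k *: t n.+1 u + t n.+1 v;
  mt_trace : forall n (u v : A n.+1), t n.+1 (u * v) = t n.+1 (v * u);
  mt_markov : forall n (u : A n.+1),
    t n.+2 (tw_incl A n.+1 u * @tw_s n.+2 ord_max) = t n.+1 u;
  mt_markovV : forall n (u : A n.+1),
    t n.+2 (tw_incl A n.+1 u * @tw_sV n.+2 ord_max) = t n.+1 u
}.

Section Quotient.
Variable P : forall n, A n -> Prop.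
Hypothesis P_incl : forall n z, @P n z -> ideal (@P n.+1) (tw_incl A n z).

Fact tquot_surj n (u : quotRing (@P n)) :
  exists h, (qproj (@P n) \o tw_pi A n) h = u.
Proof.
by have [h e] := tw_surj (qrepr u); exists h; rewrite /= e qreprK.
Qed.

Fact tquot_inclE n h : qmap (@P_incl n) ((qproj (@P n) \o tw_pi A n) h) =
  (qproj (@P n.+1) \o tw_pi A n.+1) (ga_map idfun (@bincl n) h).
Proof. by rewrite /= qmapE tw_inclE. Qed.

Definition tquot : tower K := {|
  tw_alg n := quotRing (@P n);
  tw_pi n := qproj (@P n) \o tw_pi A n;
  tw_surj := tquot_surj;
  tw_incl n := qmap (@P_incl n);
  tw_inclE := tquot_inclE
|}.
End Quotient.

Variant cubic_relator (a b c : K) n : A n -> Prop :=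
| CubicRelator (i : 'I_n.-1) : cubic_relator a b c
    ((tw_s i - tw_cst _ a) * (tw_s i - tw_cst _ b) * (tw_s i - tw_cst _ c)).

Variant quadratic_relator (b c : K) n : A n -> Prop :=
| QuadraticRelator (i : 'I_n.-1) : quadratic_relator b c
    ((tw_s i - tw_cst _ b) * (tw_s i - tw_cst _ c)).

Variant bmwt_relator (x y : K) n : A n -> Prop :=
| BmwtRelator (i j : 'I_n.-1) of j = i.+1 :> nat : bmwt_relator x y
    (- tw_cst _ y * tw_s i * tw_sV j * tw_s i
     + tw_cst _ (y ^+ 2) * tw_sV j * tw_s i * tw_sV j
     - tw_s i * tw_s j * tw_s i
     - tw_cst _ (x * y ^+ 2) * tw_sV j ^+ 2
     + tw_cst _ x * tw_s i ^+ 2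
     + tw_cst _ (y ^+ 3) * tw_sV j * tw_sV i * tw_sV j).

(* e_i = (a s_i^-1 + eps s_i) / x - eps *)
Definition bmw_e (a xV eps : K) n (i : 'I_n.-1) : A n :=
  tw_cst _ xV * (tw_cst _ a * tw_sV i + tw_cst _ eps * tw_s i) - tw_cst _ eps.

Variant bmw_relator (a xV eps : K) n : A n -> Prop :=
| BmwRelator (i j : 'I_n.-1) of i = 0%N :> nat & j = 1%N :> nat :
    bmw_relator a xV eps
      (bmw_e a xV eps i * tw_s j * bmw_e a xV eps i - bmw_e a xV eps i)
| BmwRelatorV (i j : 'I_n.-1) of i = 0%N :> nat & j = 1%N :> nat :
    bmw_relator a xV eps
      (bmw_e a xV eps i * tw_sV j * bmw_e a xV eps i - bmw_e a xV eps i).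

Let inclE := (tw_incl_cst, tw_incl_s, tw_incl_sV).

Fact cubic_incl a b c n z : @cubic_relator a b c n z ->
  ideal (@cubic_relator a b c n.+1) (tw_incl A n z).
Proof.
case=> i; apply: ideal_gen.
by rewrite !(rmorphM (tw_incl A n)) !(rmorphB (tw_incl A n)) !inclE.
Qed.

Fact quadratic_incl b c n z : @quadratic_relator b c n z ->
  ideal (@quadratic_relator b c n.+1) (tw_incl A n z).
Proof.
case=> i; apply: ideal_gen.
by rewrite !(rmorphM (tw_incl A n)) !(rmorphB (tw_incl A n)) !inclE.
Qed.

Fact bmwt_incl x y n z : @bmwt_relator x y n z ->
  ideal (@bmwt_relator x y n.+1) (tw_incl A n z).
Proof.
case=> i j ij; apply: ideal_gen.
rewrite !(rmorphD (tw_incl A n), rmorphB (tw_incl A n)).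
rewrite !(rmorphM (tw_incl A n), rmorphN (tw_incl A n)) !inclE.
exact: BmwtRelator.
Qed.

Lemma tw_incl_e a xV eps n (i : 'I_n.-1) : tw_incl A n (bmw_e a xV eps i) =
  @bmw_e a xV eps n.+1 (widen_ord (leq_pred n) i).
Proof.
rewrite (rmorphB (tw_incl A n)) (rmorphM (tw_incl A n)) (rmorphD (tw_incl A n)).
by rewrite !(rmorphM (tw_incl A n)) !inclE.
Qed.

Fact bmw_incl a xV eps n z : @bmw_relator a xV eps n z ->
  ideal (@bmw_relator a xV eps n.+1) (tw_incl A n z).
Proof.
case=> i j i0 j1; apply: ideal_gen;
  rewrite (rmorphB (tw_incl A n)) !(rmorphM (tw_incl A n)) !tw_incl_e !inclE.
- exact: BmwRelator.
- exact: BmwRelatorV.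
Qed.

End Tower.

Arguments tw_s {K A n} i.
Arguments tw_sV {K A n} i.

Section BraidTower.
Variable K : comPzRingType.

Fact braid_tower_surj n (u : grpalg K (braid n)) : exists h, idfun h = u.
Proof. by exists u. Qed.

Definition braid_tower : tower K := {|
  tw_alg n := grpalg K (braid n);
  tw_pi n := idfun;
  tw_surj := braid_tower_surj;
  tw_incl n := ga_map idfun (@bincl n);
  tw_inclE n h := erefl
|}.
End BraidTower.

Section BaseRing.
Import mpoly.

Definition Q3 : comPzRingType := {mpoly rat[3]}.
Definition a0 : Q3 := 'X_(@Ordinal 3 0 isT).
Definition b0 : Q3 := 'X_(@Ordinal 3 1 isT).
Definition c0 : Q3 := 'X_(@Ordinal 3 2 isT).
End BaseRing.

Definition ringR : comPzRingType := loc (a0 * b0 * c0).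
HB.lock Definition ra : ringR := locin _ a0.
HB.lock Definition rb : ringR := locin _ b0.
HB.lock Definition rc : ringR := locin _ c0.
Definition rx : ringR := rb + rc.
Definition ry : ringR := rb * rc.

Definition ringS : comPzRingType := loc rx.
Definition R_S : {rmorphism ringR -> ringS} := locin rx.
Definition rxV : ringS := locinv rx.

(* The sign e follows MathComp: S_+ = Spm false, S_- = Spm true. *)
Definition Spm (e : bool) : comPzRingType :=
  quotRing (fun z : ringS => z = R_S (ra - (-1) ^+ e * ry)).
Definition S_Spm (e : bool) : {rmorphism ringS -> Spm e} := qproj _.
Definition R_Spm (e : bool) : {rmorphism ringR -> Spm e} := S_Spm e \o R_S.

Definition Sbar : comPzRingType :=
  quotRing (fun z : ringS => z = R_S (ra ^+ 2 - ry ^+ 2)).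

Definition Sdag : comPzRingType :=
  quotRing (fun z : ringS => z = R_S (ra ^+ 2 - 1) \/ z = R_S (ry - 1)).
Definition S_Sdag : {rmorphism ringS -> Sdag} := qproj _.
Definition R_Sdag : {rmorphism ringR -> Sdag} := S_Sdag \o R_S.

Fact Sbar_Spm_subproof (e : bool) (z : ringS) : z = R_S (ra ^+ 2 - ry ^+ 2) ->
  ideal (fun z : ringS => z = R_S (ra - (-1) ^+ e * ry)) (idfun z).
Proof.
move=> ->.
have -> : ra ^+ 2 - ry ^+ 2 = (ra + (-1) ^+ e * ry) * (ra - (-1) ^+ e * ry).
  by case: e; rewrite ?expr1 ?expr0; ring.
by rewrite [idfun _]rmorphM; apply: idealMl; exact: ideal_gen.
Qed.
Definition Sbar_Spm (e : bool) : {rmorphism Sbar -> Spm e} :=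
  qmap (@Sbar_Spm_subproof e).

Fact Sbar_Sdag_subproof (z : ringS) : z = R_S (ra ^+ 2 - ry ^+ 2) ->
  ideal (fun z : ringS => z = R_S (ra ^+ 2 - 1) \/ z = R_S (ry - 1)) (idfun z).
Proof.
move=> ->.
have -> : ra ^+ 2 - ry ^+ 2 = (ra ^+ 2 - 1) + (- (ry + 1)) * (ry - 1).
  by ring.
rewrite [idfun _](rmorphD R_S) (rmorphM R_S); apply: idealD.
  by apply: ideal_gen; left.
by apply: idealMl; apply: ideal_gen; right.
Qed.
Definition Sbar_Sdag : {rmorphism Sbar -> Sdag} := qmap Sbar_Sdag_subproof.

Definition Sdag1 : comPzRingType := loc (R_Sdag (ra - rx)).
Definition Sdag_Sdag1 : {rmorphism Sdag -> Sdag1} := locin _.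
Definition SdagV : comPzRingType := loc (Sdag_Sdag1 (R_Sdag (2 * ra - rx))).
Definition Sdag_SdagV : {rmorphism Sdag -> SdagV} := locin _ \o Sdag_Sdag1.
Definition R_SdagV : {rmorphism ringR -> SdagV} := Sdag_SdagV \o R_Sdag.

(* H_n (x)_R K, for a commutative R-algebra rho : R -> K *)
Definition Halg (K : comPzRingType) (rho : {rmorphism ringR -> K}) : tower K :=
  tquot (@cubic_incl _ (braid_tower K) (rho ra) (rho rb) (rho rc)).

Definition BMWt : tower ringR := tquot (@bmwt_incl _ (Halg idfun) rx ry).

Definition Hecke : tower ringR :=
  tquot (@quadratic_incl _ (braid_tower ringR) rb rc).

Definition BMW (e : bool) : tower (Spm e) :=
  tquot (@bmw_incl _ (Halg (R_Spm e)) (R_Spm e ra) (S_Spm e rxV) ((-1) ^+ e)).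

(* factoring through Hecke is expressed on the images of elements of R B_n *)
Definition ocneanu_trace (t : forall n, BMWt n -> restr R_S) : Prop :=
  [/\ markov_trace t, t 1%N 1 = 1
    & exists u : forall n, Hecke n -> ringS,
        forall n h, t n.+1 (tw_pi BMWt _ h) = u n.+1 (tw_pi Hecke _ h)].

(* the Kauffman trace, through the values at 1 that determine it *)
Definition kauffman_trace (e : bool) (t : forall n, BMW e n -> (Spm e)^o) :
    Prop :=
  [/\ markov_trace t, t 1%N 1 = 1
    & t 2%N 1 = S_Spm e (R_S (ry - (-1) ^+ e * rx + 1) * rxV)].

(* Sbar = S_+ (+) S_- is realized by (Sbar_Spm false, Sbar_Spm true). The map
   from BMWt_n to BMW_n^e is induced by R B_n -> (Spm e) B_n. *)
Definition kauffman_pair_trace (t : forall n, BMWt n -> Sbar) : Prop :=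
  exists2 tpm : forall e n, BMW e n -> (Spm e)^o,
    forall e, kauffman_trace (tpm e)
    & forall e n (h : grpalg ringR (braid n.+1)),
        Sbar_Spm e (t n.+1 (tw_pi BMWt _ h)) =
        tpm e n.+1 (tw_pi (BMW e) _ (ga_map (R_Spm e) idfun h)).

Definition psi_morphism (psi : forall n, {rmorphism BMWt n -> Sdag}) : Prop :=
  (forall n k, psi n (tw_cst BMWt n k) = R_Sdag k) /\
  (forall n (i : 'I_n.-1), psi n (tw_s i) = R_Sdag ra).

Definition tdag (psi : forall n, {rmorphism BMWt n -> Sdag}) n (u : BMWt n) :
  restr R_Sdag := R_Sdag ra ^+ n * psi n u.

Arguments tdag psi n u : clear implicits.

(* Main.v *)
(* The relation R_1 = 0 expresses s_2^-1 s_1 s_2^-1 through words with at most one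
   letter s_2^{+-1}, since y is a unit, and s_2 s_1^-1 s_2 reduces to it by the
   braid and cubic relations. Hence the algebra on three strands is spanned by
   the A_2 m A_2 with m in {1, s_2, s_2^-1}, and every Markov trace satisfies
   t_3(u) = k t_1(1) + l t_2(1) + m t_3(1) with k, l, m in R depending only on
   u. For the Ocneanu and Kauffman traces and for a t^dag, the triple
   (t_1(1), t_2(1), t_3(1)) is (1, d, d^2) with, over S^dag (where y = 1 and
   a^2 = 1), d = 2/x, d = 2/x - a and d = a. The three differences of these
   nodes are a, (2a - x) a/x and 2a (a - x)/x, so the Vandermonde matrix is
   invertible as soon as a - x and 2a - x are. *)

Require Import Defs.
From HB Require Import structures.
From mathcomp Require Import all_boot all_algebra.
From mathcomp Require mpoly.
From mathcomp Require Import finmap monalg ring.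

Set Implicit Arguments.
Unset Strict Implicit.
Unset Printing Implicit Defensive.

Import GRing.Theory.
Local Open Scope ring_scope.

(** * Maps out of quotient rings and group algebras *)

Lemma qproj_eq0 (A : pzRingType) (P : A -> Prop) z : ideal P z -> qproj P z = 0.
Proof.
by move=> Pz; rewrite -(rmorph0 (qproj P)); apply/qproj_eq; rewrite subr0.
Qed.

Section Lift.
Variables (A B : pzRingType) (P : A -> Prop) (f : {rmorphism A -> B}).
Hypothesis fP : forall z, P z -> f z = 0.

(** The hypothesis is an argument of the definition, so that the ring morphism instances declared
    below attach to the term [qlift fP] itself. *)
Definition qlift of (forall z, P z -> f z = 0) :=
  fun u : quotRing P => f (qrepr u).

Lemma qliftE u : qlift fP (qproj P u) = f u.
Proof.
apply/eqP; rewrite -subr_eq0 -rmorphB; apply/eqP.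
elim: (qprojK P u) => {u} [z /fP||u v _ iu _ iv|u v _ iv|u v _ iu] //.
- exact: rmorph0.
- by rewrite rmorphD iu iv addr0.
- by rewrite rmorphM iv mulr0.
- by rewrite rmorphM iu mul0r.
Qed.

Fact qlift_zmod_morphism : zmod_morphism (qlift fP).
Proof.
move=> u v; rewrite -[u]qreprK -[v]qreprK -(rmorphB (qproj P)).
by rewrite !qliftE rmorphB.
Qed.
Fact qlift_monoid_morphism : monoid_morphism (qlift fP).
Proof.
split=> [|u v]; first by rewrite -(rmorph1 (qproj P)) qliftE rmorph1.
rewrite -[u]qreprK -[v]qreprK -(rmorphM (qproj P)).
by rewrite !qliftE rmorphM.
Qed.
HB.instance Definition _ := GRing.isZmodMorphism.Build _ _ (qlift fP)
  qlift_zmod_morphism.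
HB.instance Definition _ := GRing.isMonoidMorphism.Build _ _ (qlift fP)
  qlift_monoid_morphism.
End Lift.

Section Evaluation.
Variables (K L : comPzRingType) (G : groupType).
Variables (rho : {rmorphism K -> L}) (chi : G -> L).
Hypothesis chi1 : chi 1%g = 1.
Hypothesis chiM : forall x y, chi (x * y)%g = chi x * chi y.

(** The extension to the group algebra of a character [chi] of [G]. The two laws of [chi] are
    arguments for the same reason as in [qlift]. *)
Definition ga_eval of chi 1%g = 1
    & (forall x y, chi (x * y)%g = chi x * chi y) :=
  fun g : grpalg K G => \sum_(x <- msupp g) rho g@_x * chi x.
Notation ev := (ga_eval chi1 chiM).

Lemma ga_evalw (d : {fset G}) g : (msupp g `<=` d)%fset ->
  ev g = \sum_(x <- d) rho g@_x * chi x.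
Proof.
move=> le; apply/big_fset_incl => // x _ /mcoeff_outdom ->.
by rewrite rmorph0 mul0r.
Qed.

Lemma ga_evalU k x : ev << k *g x >> = rho k * chi x.
Proof. by rewrite (ga_evalw msuppU_le) big_seq_fset1 mcoeffUU. Qed.

Lemma ga_eval_mono k x : ev (ga_mono k x) = rho k * chi x.
Proof. by rewrite ga_mono.unlock ga_evalU. Qed.

Fact ga_eval_zmod_morphism : zmod_morphism ev.
Proof.
move=> g h; pose d := (msupp g `|` msupp h)%fset.
rewrite (@ga_evalw d g) ?fsubsetUl // (@ga_evalw d h) ?fsubsetUr //.
rewrite (@ga_evalw d) ?msuppB_le // -sumrB; apply: eq_bigr => x _ /=.
by rewrite mcoeffB rmorphB mulrBl.
Qed.
HB.instance Definition _ := GRing.isZmodMorphism.Build _ _ ev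
  ga_eval_zmod_morphism.

Fact ga_eval_monoid_morphism : monoid_morphism ev.
Proof.
split=> [|g h]; first by rewrite [LHS]ga_eval_mono rmorph1 mul1r.
elim/ga_ind: g => [|g1 g2 IH1 IH2|k x].
- by rewrite mul0r raddf0 mul0r.
- by rewrite mulrDl !raddfD /= mulrDl IH1 IH2.
elim/ga_ind: h => [|g1 g2 IH1 IH2|l y].
- by rewrite mulr0 raddf0 mulr0.
- by rewrite mulrDr !raddfD /= mulrDr IH1 IH2.
have := ga_monoM k l x y; rewrite ga_mono.unlock => ->.
by rewrite !ga_evalU rmorphM chiM mulrACA.
Qed.
HB.instance Definition _ := GRing.isMonoidMorphism.Build _ _ ev
  ga_eval_monoid_morphism.
End Evaluation.

(** * Central scalars, letters and the braid relation in a tower *)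

Section Tower.
Variables (K : comPzRingType) (A : tower K).

Lemma ga_monoE (G : groupType) k (x : G) :
  ga_mono k x = ga_cst G k * ga_gen K x.
Proof. by rewrite /ga_cst /ga_gen ga_monoM mulr1 mul1g. Qed.

Lemma ga_genM (G : groupType) (x y : G) :
  ga_gen K (x * y)%g = ga_gen K x * ga_gen K y.
Proof. by rewrite /ga_gen ga_monoM mulr1. Qed.

Lemma bclass_cons n (p : 'I_n.-1 * bool) w :
  bclass (p :: w) = ((if p.2 then sigma p.1 else (sigma p.1)^-1) * bclass w)%g.
Proof.
case: p => i [] /=; last by rewrite [(sigma i)^-1%g]binvE [RHS]bmulE.
by rewrite [RHS]bmulE.
Qed.

Lemma ga_cstC (G : groupType) k (h : grpalg K G) :
  h * ga_cst G k = ga_cst G k * h.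
Proof.
elim/ga_ind: h => [|g h IH1 IH2|l x]; first by rewrite mul0r mulr0.
  by rewrite mulrDl mulrDr IH1 IH2.
have -> : << l *g x >> = ga_mono l x by rewrite ga_mono.unlock.
by rewrite /ga_cst !ga_monoM mulrC mul1g mulg1.
Qed.

Lemma tw_cstE n k : tw_cst A n k = tw_pi A n (ga_cst _ k).
Proof. by []. Qed.

Lemma tw_cstC n k (u : A n) : u * tw_cst A n k = tw_cst A n k * u.
Proof.
have [h <-] := tw_surj u; rewrite tw_cstE.
apply: (etrans (esym (rmorphM (tw_pi A n) h (ga_cst _ k)))).
apply: (etrans _ (rmorphM (tw_pi A n) (ga_cst _ k) h)).
by rewrite ga_cstC.
Qed.

(** Every element comes from the group algebra, hence is a combination of braids, and a braid word
    grows from 1 by left multiplication by letters. Spanning sets are verified below through this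
    principle. *)
Lemma tw_ind n (T : A n -> Prop) : T 1 ->
  (forall u v, T u -> T v -> T (u + v)) ->
  (forall k u, T u -> T (tw_cst A n k * u)) ->
  (forall i u, T u -> T (tw_s i * u)) -> (forall i u, T u -> T (tw_sV i * u)) ->
  forall u, T u.
Proof.
move=> T1 TD TZ Ts TsV u; have [h <-] := tw_surj u.
elim/ga_ind: h => [|g h IH1 IH2|k x].
- by rewrite rmorph0 -(mul0r 1) -(rmorph0 (tw_cst A n)); exact: TZ.
- by rewrite rmorphD; exact: TD.
have -> : << k *g x >> = ga_cst _ k * ga_gen K x.
  by rewrite -ga_monoE ga_mono.unlock.
rewrite rmorphM; apply: TZ; rewrite -[x]bwordK.
elim: (bword x) => [|[i e] w IH].
  by rewrite (_ : ga_gen K _ = 1) ?rmorph1.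
by rewrite bclass_cons ga_genM rmorphM; case: e; [exact: Ts | exact: TsV].
Qed.

Lemma tw_ssV n (i : 'I_n.-1) : tw_s i * tw_sV i = 1 :> A n.
Proof.
by rewrite /tw_s /tw_sV -rmorphM -ga_genM mulgV (_ : ga_gen K _ = 1) ?rmorph1.
Qed.

Lemma tw_sVs n (i : 'I_n.-1) : tw_sV i * tw_s i = 1 :> A n.
Proof.
by rewrite /tw_s /tw_sV -rmorphM -ga_genM mulVg (_ : ga_gen K _ = 1) ?rmorph1.
Qed.

Lemma tw_incl_ssV n (i : 'I_n.-1) :
  tw_incl A n (tw_s i) * tw_incl A n (tw_sV i) = 1.
Proof. by rewrite -rmorphM tw_ssV rmorph1. Qed.

Lemma tw_incl_sVs n (i : 'I_n.-1) :
  tw_incl A n (tw_sV i) * tw_incl A n (tw_s i) = 1.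
Proof. by rewrite -rmorphM tw_sVs rmorph1. Qed.

Lemma tw_braid n (i j : 'I_n.-1) : j = i.+1 :> nat ->
  tw_s i * tw_s j * tw_s i = tw_s j * tw_s i * tw_s j :> A n.
Proof.
move=> ij; rewrite /tw_s -!rmorphM -!ga_genM; congr (tw_pi A n (ga_gen K _)).
have sssE k l m : (sigma k * sigma l * sigma m)%g =
    bclass [:: (k, true); (l, true); (m, true)] :> braid n.
  by rewrite !bclass_cons /= mulg1 mulgA.
by rewrite !sssE; apply/bclassP; exact: be_braid.
Qed.

End Tower.

(** * Spanning sets of the algebras on two and three strands *)

Section Span.
Variables (K : comPzRingType) (A : tower K) (n : nat).

(** [A n] is only a ring, so the linear span uses the elements [tw_cst A n k] as scalars; they are
    central by [tw_cstC]. *)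
Inductive tspan (P : A n -> Prop) : A n -> Prop :=
| tspan_gen z : P z -> tspan P z
| tspan0 : tspan P 0
| tspanD u v : tspan P u -> tspan P v -> tspan P (u + v)
| tspanZ k v : tspan P v -> tspan P (tw_cst A n k * v).

Lemma tspanN P u : tspan P u -> tspan P (- u).
Proof.
by move=> Pu; rewrite -mulN1r -(rmorph1 (tw_cst A n)) -rmorphN; exact: tspanZ.
Qed.

Lemma tspanB P u v : tspan P u -> tspan P v -> tspan P (u - v).
Proof. by move=> Pu Pv; apply: tspanD => //; exact: tspanN. Qed.

Lemma tspan_unitZ P k l u : l * k = 1 ->
  tspan P (tw_cst A n k * u) -> tspan P u.
Proof.
move=> lk /(tspanZ l); rewrite mulrA -(rmorphM (tw_cst A n)) lk.
by rewrite rmorph1 mul1r.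
Qed.

Lemma tspan_cst P k : P 1 -> tspan P (tw_cst A n k).
Proof. by move=> P1; rewrite -[tw_cst A n k]mulr1; apply/tspanZ/tspan_gen. Qed.

Lemma tspan_mull P Q w u :
  (forall z, P z -> tspan Q (w * z)) -> tspan P u -> tspan Q (w * u).
Proof.
move=> PQ; elim=> {u} [z /PQ||u v _ Qu _ Qv|k v _ Qv] //.
- by rewrite mulr0; exact: tspan0.
- by rewrite mulrDr; exact: tspanD.
- by rewrite mulrA tw_cstC -mulrA; exact: tspanZ.
Qed.

Lemma tspan_mulr P Q w u :
  (forall z, P z -> tspan Q (z * w)) -> tspan P u -> tspan Q (u * w).
Proof.
move=> PQ; elim=> {u} [z /PQ||u v _ Qu _ Qv|k v _ Qv] //.
- by rewrite mul0r; exact: tspan0.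
- by rewrite mulrDl; exact: tspanD.
- by rewrite -mulrA; exact: tspanZ.
Qed.

Lemma tspan_trans P Q u :
  (forall z, P z -> tspan Q z) -> tspan P u -> tspan Q u.
Proof.
move=> PQ Pu; rewrite -[u]mul1r.
by apply: tspan_mull Pu => z; rewrite mul1r => /PQ.
Qed.

End Span.

Section Powers.
Variables (K : comPzRingType) (A : tower K) (n : nat) (i : 'I_n.-1).
Variables b c : K.

(** This basis is preferred to 1, s, s^2 because the Markov conditions evaluate a trace directly on
    s and s^-1. *)
Definition letter (z : A n) : Prop := [\/ z = 1, z = tw_s i | z = tw_sV i].

(** Division by s turns the quadratic factor into a combination of letters. The resulting element
    maps to zero in the Hecke algebra and is, up to a scalar, the element e_1 of the BMW algebra. *)
Lemma quadratic_divE :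
  (tw_s i - tw_cst A n b) * (tw_s i - tw_cst A n c) * tw_sV i =
  tw_s i - tw_cst A n (b + c) + tw_cst A n (b * c) * tw_sV i.
Proof.
rewrite -mulrA (mulrBl (tw_sV i)) tw_ssV mulrBr mulr1 mulrBl.
rewrite -(tw_cstC c (tw_sV i)) (mulrA (tw_s i)) tw_ssV mul1r.
rewrite (tw_cstC c (tw_sV i)) mulrA -rmorphM rmorphD opprB opprD.
by rewrite addrA [LHS]addrAC !addrA.
Qed.

Variable a : K.
Hypothesis cubic : (tw_s i - tw_cst A n a) * (tw_s i - tw_cst A n b)
  * (tw_s i - tw_cst A n c) = 0.
Let v : A n := tw_s i - tw_cst A n (b + c) + tw_cst A n (b * c) * tw_sV i.

Lemma cubic_eigen : tw_s i * v = tw_cst A n a * v.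
Proof.
apply/eqP; rewrite -subr_eq0 -mulrBl /v -quadratic_divE !mulrA cubic.
by rewrite mul0r.
Qed.

Let letterZ k z : letter z -> tspan letter (tw_cst A n k * z).
Proof. by move=> lz; apply/tspanZ/tspan_gen. Qed.
Let letter1 : letter 1. Proof. by constructor. Qed.
Let letters : letter (tw_s i). Proof. by constructor. Qed.
Let lettersV : letter (tw_sV i). Proof. by constructor. Qed.

Lemma tspan_v : tspan letter v.
Proof.
apply: tspanD; last exact: letterZ.
by apply: tspanB; [apply: tspan_gen | apply: tspan_cst].
Qed.

(** Expanding s v = a v isolates s^2 among the letters. *)
Lemma tspan_s2 : tspan letter (tw_s i * tw_s i).
Proof.
have : tspan letter (tw_s i * v) by rewrite cubic_eigen; apply/tspanZ/tspan_v.
rewrite /v mulrDr mulrBr mulrA !tw_cstC -mulrA tw_ssV mulr1.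
set w := _ * _; set p := tw_cst A n _ * _; set k := tw_cst A n _ => h.
rewrite -[w](subrK p) -[w - p](addrK k); apply: tspanD (letterZ _ letters).
by apply: tspanB h (tspan_cst _ letter1).
Qed.

(** Multiplying [cubic_eigen] by s^-1 gives v = a s^-1 v. Its expansion contains s^-2 with
    coefficient a b c, which [eV] inverts. *)
Lemma tspan_sV2 eV : eV * (a * (b * c)) = 1 ->
  tspan letter (tw_sV i * tw_sV i).
Proof.
move=> eVK; apply: (tspan_unitZ eVK).
have vE : v = tw_cst A n a * (tw_sV i * v).
  by rewrite mulrA -tw_cstC -mulrA -cubic_eigen mulrA tw_sVs mul1r.
have : tspan letter (tw_cst A n a - tw_cst A n (a * (b + c)) * tw_sV i
    + tw_cst A n (a * (b * c)) * (tw_sV i * tw_sV i)).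
  have <- : v = tw_cst A n a - tw_cst A n (a * (b + c)) * tw_sV i
    + tw_cst A n (a * (b * c)) * (tw_sV i * tw_sV i); last exact: tspan_v.
  rewrite vE /v [tw_sV i * _]mulrDr mulrBr tw_sVs tw_cstC.
  rewrite (mulrA (tw_sV i)) tw_cstC -mulrA mulrDr mulrBr mulr1.
  by rewrite !(mulrA (tw_cst A n a)) -!rmorphM.
set w := _ * (tw_sV i * tw_sV i); set p := tw_cst A n _ * _.
set k := tw_cst A n _ => h; rewrite -[w](addKr (k - p)) opprB.
apply: tspanD h.
by apply: tspanB; [exact: letterZ lettersV | exact: tspan_cst letter1].
Qed.

End Powers.

(** Stated for abstract invertible elements, so that it also serves with s_1 and s_2 exchanged, or
    with both replaced by their inverses. *)
Lemma braid_conj (B : pzRingType) (p q pV qV : B) :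
  p * pV = 1 -> qV * q = 1 -> p * q * p = q * p * q ->
  qV * p * q = p * q * pV.
Proof.
move=> pK qK pqp; rewrite -[LHS]mulr1 -pK mulrA -(mulrA qV) -(mulrA qV).
by rewrite pqp !mulrA qK mul1r.
Qed.

(** Both sides are inverse to the same element p q p = q p q. *)
Lemma braidV (B : pzRingType) (p q pV qV : B) :
  p * pV = 1 -> pV * p = 1 -> q * qV = 1 -> qV * q = 1 ->
  p * q * p = q * p * q -> pV * qV * pV = qV * pV * qV.
Proof.
move=> pK pVK qK qVK pqp.
have l : pV * qV * pV * (p * q * p) = 1.
  by rewrite !mulrA -(mulrA _ pV) pVK mulr1 -(mulrA _ qV) qVK mulr1.
have r : (q * p * q) * (qV * pV * qV) = 1.
  by rewrite !mulrA -(mulrA _ q) qK mulr1 -(mulrA _ p) pK mulr1.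
by rewrite -[LHS]mulr1 -r mulrA -pqp l mul1r.
Qed.

Section ThreeStrands.
Variables (K : comPzRingType) (A : tower K) (a b c x y eV yV : K).
Hypothesis eVK : eV * (a * (b * c)) = 1.
Hypothesis yVK : yV * y ^+ 2 = 1.
Hypothesis cubic : forall n z, @cubic_relator K A a b c n z -> z = 0.
Hypothesis bmwt : forall n z, @bmwt_relator K A x y n z -> z = 0.

Let cubic_s n (i : 'I_n.-1) :
  (tw_s i - tw_cst A n a) * (tw_s i - tw_cst A n b)
  * (tw_s i - tw_cst A n c) = 0.
Proof. exact: cubic (CubicRelator A a b c i). Qed.

Notation letter2 := (@letter K A 2 ord_max).
Notation letter3 := (@letter K A 3 ord_max).

Lemma tspan_two_strands (u : A 2%N) : tspan letter2 u.
Proof.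
have gen z : letter2 z -> tspan letter2 z by exact: tspan_gen.
elim/tw_ind: u => [|u v|k u|i u|i u].
- by apply: gen; constructor 1.
- exact: tspanD.
- exact: tspanZ.
(* On two strands there is a single generator, so its index may be taken to be [ord_max]. *)
- rewrite (ord1 i) -(ord1 ord_max); apply: tspan_mull => z [] ->.
  + by rewrite mulr1; apply: gen; constructor 2.
  + exact: tspan_s2 (cubic_s _).
  + by rewrite tw_ssV; apply: gen; constructor 1.
rewrite (ord1 i) -(ord1 ord_max); apply: tspan_mull => z [] ->.
- by rewrite mulr1; apply: gen; constructor 3.
- by rewrite tw_sVs; apply: gen; constructor 1.
- exact: (tspan_sV2 (cubic_s _) eVK).
Qed.

Notation inc := (tw_incl A 2).
Notation s1 := (inc (@tw_s K A 2 ord_max)).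
Notation s1V := (inc (@tw_sV K A 2 ord_max)).
Notation s2 := (@tw_s K A 3 ord_max).
Notation s2V := (@tw_sV K A 3 ord_max).

(** A cyclic rotation brings such a product to an element of the image of A_2 times [m], where the
    Markov conditions apply if [m] is s_2 or s_2^-1. *)
Definition markov_form (z : A 3%N) : Prop :=
  exists u v m, letter3 m /\ z = inc u * m * inc v.

Let s1K : s1 * s1V = 1. Proof. exact: tw_incl_ssV. Qed.
Let s1VK : s1V * s1 = 1. Proof. exact: tw_incl_sVs. Qed.
Let s2K : s2 * s2V = 1. Proof. exact: tw_ssV. Qed.
Let s2VK : s2V * s2 = 1. Proof. exact: tw_sVs. Qed.

Lemma tw_incl_braid : s1 * s2 * s1 = s2 * s1 * s2.
Proof. by rewrite tw_incl_s; apply: tw_braid. Qed.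

Let V := tspan markov_form.

Let formP u m v : letter3 m -> V (inc u * m * inc v).
Proof. by move=> lm; apply: tspan_gen; exists u, v, m. Qed.

Let V_incl u z : V z -> V (inc u * z).
Proof.
apply: tspan_mull => {}z [v [w [m [lm ->]]]].
by rewrite !mulrA -rmorphM; exact: formP.
Qed.

Let V_inclr u z : V z -> V (z * inc u).
Proof.
apply: tspan_mulr => {}z [v [w [m [lm ->]]]].
by rewrite -!mulrA -rmorphM !mulrA; exact: formP.
Qed.

Let V_letter m : letter3 m -> V m.
Proof.
by move=> lm; have := formP 1 1 lm; rewrite rmorph1 mul1r mulr1.
Qed.

Let V1 : V 1. Proof. by apply: V_letter; constructor. Qed.

Let V_span m : tspan letter3 m -> V m.
Proof. exact: tspan_trans. Qed.

Let V_ss := V_span (tspan_s2 (cubic_s (ord_max : 'I_3.-1))).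
Let V_sVsV := V_span (tspan_sV2 (cubic_s (ord_max : 'I_3.-1)) eVK).

Let letter_s : letter3 s2. Proof. by constructor. Qed.
Let letter_sV : letter3 s2V. Proof. by constructor. Qed.

Let braidVV := braidV s1K s1VK s2K s2VK tw_incl_braid.

Let V_sVs1sV : V (s2V * s1 * s2V).
Proof.
apply: (tspan_unitZ yVK).
pose i : 'I_3.-1 := widen_ord (leq_pred 2) (ord_max : 'I_2.-1).
have ij : (ord_max : 'I_3.-1) = i.+1 :> nat by [].
have := bmwt (BmwtRelator A x y ij); rewrite -tw_incl_s -tw_incl_sV.
(* The relation is solved for y^2 s_2^-1 s_1 s_2^-1. Among the other terms, s_2^-2 is covered by
   [V_sVsV] and s_2^-1 s_1^-1 s_2^-1 becomes s_1^-1 s_2^-1 s_1^-1; the rest have at most one letter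
   s_2^{+-1}. *)
move/(canRL (addrK _))/(canRL (addrK _))/(canRL (subrK _)).
move/(canRL (subrK _))/(canRL (addKr _)); rewrite -!mulrA.
rewrite (mulrA s2V) => ->; rewrite mulNr opprK sub0r.
apply: tspanD; first by apply: tspanZ; rewrite mulrA; exact: formP.
apply: tspanD; last by rewrite mulrA; exact: formP.
apply: tspanD; last by apply: tspanZ; exact: V_sVsV.
apply: tspanB; last first.
  by apply: tspanZ; rewrite expr2 -rmorphM -[inc _]mulr1; exact: V_incl.
by apply/tspanN/tspanZ; rewrite mulrA -braidVV; exact: formP.
Qed.

Let V_letter_incl m u : letter3 m -> V (m * inc u).
Proof. by move=> lm; apply: V_inclr; apply: V_letter. Qed.

Let V_sVs1_letter m : letter3 m -> V (s2V * s1 * m).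
Proof.
case=> ->; rewrite ?mulr1 //; first exact: V_letter_incl.
by rewrite (braid_conj s1K s2VK tw_incl_braid); exact: formP.
Qed.

Let braid_sw : s2 * s1 * s2V = s1V * s2 * s1.
Proof.
by rewrite (braid_conj s2K s1VK (esym tw_incl_braid)).
Qed.

(* s_2 s_1^-1 s_2 = s_1^-1 s_2^-1 s_1 s_2^2, and s_2^2 is a combination of 1, s_2
   and s_2^-1. *)
Let V_ss1Vs : V (s2 * s1V * s2).
Proof.
have -> : s2 * s1V = s1V * (s2V * s1 * s2).
  by rewrite (braid_conj s1K s2VK tw_incl_braid) !mulrA s1VK mul1r.
rewrite -!mulrA; apply: V_incl; rewrite (mulrA s2V).
apply: tspan_mull (tspan_s2 (cubic_s (ord_max : 'I_3.-1))).
exact: V_sVs1_letter.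
Qed.

(** By [tspan_two_strands] the inner element may be taken to be a letter. The braid relation settles
    every pattern with a nontrivial middle letter, except s_2 s_1^-1 s_2 and s_2^-1 s_1 s_2^-1,
    which were treated above. *)
Let V_middle u m m' : letter3 m -> letter3 m' -> V (m * inc u * m').
Proof.
move=> lm lm'; move: (tspan_two_strands u).
elim=> {u} [u|||]; last 3 first.
- by rewrite rmorph0 mulr0 mul0r; exact: tspan0.
- by move=> u v _ Vu _ Vv; rewrite rmorphD mulrDr mulrDl; exact: tspanD.
- move=> k v _ Vv; rewrite rmorphM tw_incl_cst mulrA tw_cstC -!mulrA.
  by apply: tspanZ; rewrite mulrA.
have Vl w : V (1 * inc w * m') by rewrite mul1r; apply/V_incl/V_letter.
have Vr w : V (m * inc w * 1) by rewrite mulr1; apply/V_letter_incl.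
case: lm Vr => ->; first by move=> _ _; exact: Vl.
- case: lm' {Vl} => -> Vr; first by move=> _; exact: Vr.
  + case=> ->; rewrite ?rmorph1 ?mulr1; first exact: V_ss.
      by rewrite -tw_incl_braid; exact: formP.
    exact: V_ss1Vs.
  + case=> ->; rewrite ?rmorph1 ?mulr1; first by rewrite s2K.
      by rewrite braid_sw; exact: formP.
    by rewrite (braid_conj s1VK s2K braidVV); exact: formP.
case: lm' {Vl} => -> Vr; first by move=> _; exact: Vr.
- case=> ->; rewrite ?rmorph1 ?mulr1; first by rewrite s2VK.
    by apply: V_sVs1_letter; constructor.
  by rewrite -(braid_conj s2VK s1K (esym braidVV)); exact: formP.
- case=> ->; rewrite ?rmorph1 ?mulr1; first exact: V_sVsV.
    exact: V_sVs1sV.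
  by rewrite -braidVV; exact: formP.
Qed.

Lemma tspan_three_strands (z : A 3%N) : tspan markov_form z.
Proof.
(* Left multiplication by a letter of s_2 creates a product with two such letters, which [V_middle]
   brings back into the span. *)
have Vmul m w : letter3 m -> V w -> V (m * w).
  move=> lm; apply: tspan_mull => _ [u [v [m' [lm' ->]]]].
  by rewrite !mulrA; apply/V_inclr/V_middle.
have ordP (i : 'I_3.-1) :
    i = widen_ord (leq_pred 2) (ord_max : 'I_2.-1) \/ i = ord_max.
  by case: i => [[|[|]]] // h; [left | right]; apply: val_inj.
elim/tw_ind: z => [|u v|k u|i u Vu|i u Vu] //.
- exact: tspanD.
- exact: tspanZ.
- case: (ordP i) => ->; last exact: Vmul.
  by rewrite -tw_incl_s; exact: V_incl.
- case: (ordP i) => ->; last exact: Vmul.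
  by rewrite -tw_incl_sV; exact: V_incl.
Qed.

End ThreeStrands.

(** * Markov traces are determined on three strands by three values *)

Section MarkovTrace.
Variables (K : comPzRingType) (A : tower K) (M : lmodType K).
Variables (t : forall n, A n -> M).
Hypothesis mt : markov_trace t.

Lemma mtD n (u v : A n.+1) : t (u + v) = t u + t v.
Proof.
by have := mt_linear mt 1 u v; rewrite rmorph1 mul1r scale1r.
Qed.

Lemma mt0 n : t (0 : A n.+1) = 0.
Proof. by apply: (addrI (t (0 : A n.+1))); rewrite -mtD !addr0. Qed.

Lemma mtZ n k (u : A n.+1) : t (tw_cst A n.+1 k * u) = k *: t u.
Proof. by have := mt_linear mt k u 0; rewrite mt0 !addr0. Qed.

Lemma mtN n (u : A n.+1) : t (- u) = - t u.
Proof. by apply: (addrI (t u)); rewrite -mtD !subrr mt0. Qed.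

Lemma mt_cst n k : t (tw_cst A n.+1 k) = k *: t (1 : A n.+1).
Proof. by rewrite -mtZ mulr1. Qed.

Lemma mt_s n : t (@tw_s K A n.+2 ord_max) = t (1 : A n.+1).
Proof. by have := mt_markov mt (1 : A n.+1); rewrite rmorph1 mul1r. Qed.

Lemma mt_sV n : t (@tw_sV K A n.+2 ord_max) = t (1 : A n.+1).
Proof. by have := mt_markovV mt (1 : A n.+1); rewrite rmorph1 mul1r. Qed.

(** The braid relation gives p = (q p) q (q p)^-1, so p and q are conjugate. *)
Lemma mt_conj n (p q pV qV : A n.+1) : pV * p = 1 -> qV * q = 1 ->
  p * q * p = q * p * q -> p * pV = 1 -> q * qV = 1 -> t p = t q.
Proof.
move=> pK qK pqp pVK qVK; have -> : p = q * p * q * (pV * qV).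
  by rewrite -pqp mulrA -(mulrA _ p) pVK mulr1 -mulrA qVK mulr1.
rewrite (mt_trace mt); congr t.
by rewrite -(mulrA q) mulrA -(mulrA pV) qK mulr1 mulrA pK mul1r.
Qed.

(** In A_3 the Markov condition removes s_2, not s_1; but s_1 is conjugate to s_2. *)
Lemma mt_incl_s : t (tw_incl A 2 (@tw_s K A 2 ord_max)) = t (1 : A 2%N).
Proof.
rewrite -mt_s.
apply: (@mt_conj _ _ _ (tw_incl A 2 (@tw_sV K A 2 ord_max))
  (@tw_sV K A 3 ord_max)).
- exact: tw_incl_sVs.
- exact: tw_sVs.
- exact: tw_incl_braid.
- exact: tw_incl_ssV.
- exact: tw_ssV.
Qed.

Lemma mt_incl_sV : t (tw_incl A 2 (@tw_sV K A 2 ord_max)) = t (1 : A 2%N).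
Proof.
rewrite -mt_sV.
apply: (@mt_conj _ _ _ (tw_incl A 2 (@tw_s K A 2 ord_max))
  (@tw_s K A 3 ord_max)).
- exact: tw_incl_ssV.
- exact: tw_ssV.
- by apply: braidV (tw_incl_braid A);
    rewrite ?tw_incl_ssV ?tw_incl_sVs ?tw_ssV ?tw_sVs.
- exact: tw_incl_sVs.
- exact: tw_sVs.
Qed.

End MarkovTrace.

Section Determined.
Variables (K : comPzRingType) (A : tower K) (a b c x y eV yV : K).
Hypothesis eVK : eV * (a * (b * c)) = 1.
Hypothesis yVK : yV * y ^+ 2 = 1.
Hypothesis cubic : forall n z, @cubic_relator K A a b c n z -> z = 0.
Hypothesis bmwt : forall n z, @bmwt_relator K A x y n z -> z = 0.

(** The coefficients are chosen before the module and the trace, so that one choice serves all the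
    traces to be compared. *)
Lemma markov_trace_two (u : A 2%N) : exists k l : K,
  forall (M : lmodType K) (t : forall n, A n -> M), markov_trace t ->
    t _ u = k *: t 1%N 1 + l *: t 2%N 1.
Proof.
elim: (tspan_two_strands eVK cubic u) => {u} [u|||].
- case=> ->; [exists 0, 1|exists 1, 0|exists 1, 0] => M t mt.
  + by rewrite scale0r add0r scale1r.
  + by rewrite mt_s // scale0r addr0 scale1r.
  + by rewrite mt_sV // scale0r addr0 scale1r.
- by exists 0, 0 => M t mt; rewrite mt0 // !scale0r addr0.
- move=> u v _ [k1 [l1 IH1]] _ [k2 [l2 IH2]]; exists (k1 + k2), (l1 + l2).
  by move=> M t mt; rewrite mtD // IH1 // IH2 // !scalerDl addrACA.
- move=> k u _ [k1 [l1 IH1]]; exists (k * k1), (k * l1).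
  by move=> M t mt; rewrite mtZ // IH1 // scalerDr !scalerA.
Qed.

Lemma markov_trace_three (u : A 3%N) : exists k l m : K,
  forall (M : lmodType K) (t : forall n, A n -> M), markov_trace t ->
    t _ u = k *: t 1%N 1 + l *: t 2%N 1 + m *: t 3%N 1.
Proof.
pose T (u : A 3%N) := exists k l m : K,
  forall (M : lmodType K) (t : forall n, A n -> M), markov_trace t ->
    t _ u = k *: t 1%N 1 + l *: t 2%N 1 + m *: t 3%N 1.
have T0 : T 0.
  by exists 0, 0, 0 => M t mt; rewrite mt0 // !scale0r !addr0.
have TD z w : T z -> T w -> T (z + w).
  move=> [k1 [l1 [m1 IH1]]] [k2 [l2 [m2 IH2]]].
  exists (k1 + k2), (l1 + l2), (m1 + m2) => M t mt.
  by rewrite mtD // IH1 // IH2 // !scalerDl addrACA [X in X + _ = _]addrACA.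
have TZ k z : T z -> T (tw_cst A 3 k * z).
  move=> [k1 [l1 [m1 IH1]]]; exists (k * k1), (k * l1), (k * m1) => M t mt.
  by rewrite mtZ // IH1 // !scalerDr !scalerA.
(* When m = 1 there is no letter s_2 for the Markov condition to remove, and the value is found on
   the letters spanning A_2. This is where t_3(1) enters. *)
have T2 v : T (tw_incl A 2 v).
  elim: (tspan_two_strands eVK cubic v) => {v} [v|||].
  - case=> ->; [exists 0, 0, 1|exists 0, 1, 0|exists 0, 1, 0] => M t mt.
    + by rewrite rmorph1 !scale0r !add0r scale1r.
    + by rewrite mt_incl_s // !scale0r addr0 add0r scale1r.
    + by rewrite mt_incl_sV // !scale0r addr0 add0r scale1r.
  - by rewrite rmorph0.
  - by move=> v w _ Tv _ Tw; rewrite rmorphD; exact: TD.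
  - by move=> k v _ Tv; rewrite rmorphM tw_incl_cst; exact: TZ.
elim: (tspan_three_strands eVK yVK cubic bmwt u) => {u}
  [_ [v [w [m [lm ->]]]]|||] //.
(* The trace property moves the right factor to the front. *)
- suff: T (tw_incl A 2 (w * v) * m).
    move=> [k1 [l1 [m1 IH]]]; exists k1, l1, m1 => M t mt.
    by rewrite (mt_trace mt) mulrA -rmorphM IH.
  have [k [l IH]] := markov_trace_two (w * v).
  case: lm => ->; first by rewrite mulr1.
  + exists k, l, 0 => M t mt.
    by rewrite (mt_markov mt) IH // scale0r addr0.
  + exists k, l, 0 => M t mt.
    by rewrite (mt_markovV mt) IH // scale0r addr0.
- by move=> z w _ Tz _ Tw; exact: TD.
- by move=> k z _ Tz; exact: TZ.
Qed.

End Determined.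

(** * Values of the Ocneanu and Kauffman traces at 1 *)

Lemma mt_quadratic (K : comPzRingType) (A : tower K) (M : lmodType K)
    (t : forall n, A n -> M) (b c : K) n : markov_trace t ->
  t _ (@tw_s K A n.+2 ord_max - tw_cst A n.+2 (b + c)
    + tw_cst A n.+2 (b * c) * @tw_sV K A n.+2 ord_max) =
  (1 + b * c) *: t n.+1 1 - (b + c) *: t n.+2 1.
Proof.
move=> mt; rewrite !(mtD mt) (mtN mt) (mt_cst mt) (mtZ mt) (mt_s mt) (mt_sV mt).
by rewrite scalerDl scale1r addrAC.
Qed.

Section Kauffman.
Variables (K : comPzRingType) (A : tower K) (a b c x xV eps : K).
Hypotheses (aE : a = eps * (b * c)) (eps2 : eps * eps = 1).
Hypotheses (xE : x = b + c) (xK : x * xV = 1).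
Hypothesis cubic : forall n z, @cubic_relator K A a b c n z -> z = 0.
Hypothesis bmw : forall n z, @bmw_relator K A a xV eps n z -> z = 0.
Variable (t : forall n, A n -> K^o).
Hypothesis mt : markov_trace t.
Let d := xV * (b * c - eps * x + 1).
Let s := @tw_s K A 2 ord_max.
Let sV := @tw_sV K A 2 ord_max.
Let e := bmw_e A a xV eps (ord_max : 'I_2.-1).
Let cst := tw_cst A 2.

(** Thus e_1 is a multiple of the element of [quadratic_divE], hence an eigenvector of s_1 by
    [cubic_eigen]. *)
Let eE : e = cst (eps * xV) * (s - cst (b + c) + cst (b * c) * sV).
Proof.
rewrite /e /bmw_e -/s -/sV -/cst [RHS]mulrDr mulrBr mulrDr !mulrA -!rmorphM.
have -> : eps * xV * (b + c) = eps by rewrite -xE -mulrA (mulrC xV) xK mulr1.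
have -> : eps * xV * (b * c) = xV * a by rewrite aE; ring.
by rewrite (mulrC xV eps) [cst _ * sV + _]addrC addrAC.
Qed.

Let se : s * e = cst a * e.
Proof.
rewrite eE mulrA tw_cstC -mulrA (cubic_eigen (cubic (CubicRelator A a b c _))).
by rewrite !mulrA -!rmorphM mulrC.
Qed.

(** From s_1 e_1 = a e_1 one gets a s_1^-1 e_1 = e_1, so the left factor e_1 acts as (1 + eps a)/x -
    eps, and eps a = b c. *)
Let ee : e * e = cst d * e.
Proof.
have sVe : cst a * sV * e = e by rewrite -tw_cstC -mulrA -se mulrA tw_sVs mul1r.
rewrite {1}/e /bmw_e -/s -/sV -/cst mulrBl -mulrA mulrDl sVe -(mulrA _ s) se.
rewrite -{1}[e]mul1r -(rmorph1 cst) !mulrA -rmorphM -mulrDl -rmorphD.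
rewrite mulrA -rmorphM -mulrBl -rmorphB; congr (cst _ * _).
rewrite /d aE mulrA eps2 mul1r -[in LHS](mulr1 eps) -xK; ring.
Qed.

(* Evaluate t_3 on both sides of e_1 s_2 e_1 = e_1, knowing that e_1^2 = d e_1. *)
Lemma kauffman_three : @t 1%N 1 = 1 -> @t 2%N 1 = d -> @t 3%N 1 = d ^+ 2.
Proof.
move=> t1 t2.
have te : @t 2%N e = xV * (a + eps) - eps * d.
  rewrite /e /bmw_e (mtD mt) (mtN mt) (mt_cst mt) (mtZ mt) (mtD mt) !(mtZ mt).
  by rewrite (mt_s mt) (mt_sV mt) t1 t2 /GRing.scale /= !mulr1.
have tie : @t 3%N (tw_incl A 2 e) = xV * (a * d + eps * d) - eps * @t 3%N 1.
  rewrite rmorphB rmorphM rmorphD !rmorphM !tw_incl_cst.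
  rewrite (mtD mt) (mtN mt) (mt_cst mt) (mtZ mt) (mtD mt) !(mtZ mt).
  by rewrite (mt_incl_s mt) (mt_incl_sV mt) t2.
have ese : tw_incl A 2 e * @tw_s K A 3 ord_max * tw_incl A 2 e = tw_incl A 2 e.
  apply/eqP; rewrite -subr_eq0; apply/eqP; rewrite /e tw_incl_e.
  by apply: bmw; constructor.
have : @t 3%N (tw_incl A 2 e) = d * @t 2%N e.
  by rewrite -ese (mt_trace mt) mulrA -rmorphM ee (mt_markov mt) (mtZ mt).
rewrite tie te; move: (@t 3%N 1 : K) => z zE.
(* The terms in (a + eps) d / x cancel, leaving eps z = eps d^2; the extra factor eps makes [eps2]
   applicable. *)
have : eps * (eps * z) = eps * (eps * d ^+ 2).
  congr (eps * _); apply: oppr_inj; apply: (addrI (xV * (a * d + eps * d))).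
  by rewrite [LHS]zE /=; move: d => d'; ring.
by move=> h; rewrite -[LHS](mul1r z) -[RHS](mul1r (d ^+ 2)) -eps2 -!(mulrA eps).
Qed.
End Kauffman.

Section Ocneanu.
Variables (A : tower ringR) (M : lmodType ringR) (t : forall n, A n -> M).
Hypothesis mt : markov_trace t.
Variable u : forall n, Hecke n -> M.
Hypothesis tu : forall n h, t (tw_pi A n.+1 h) = u (tw_pi Hecke n.+1 h).

(** The trace of the element of [quadratic_divE] vanishes, because the trace factors through the
    Hecke algebra, where that element is zero. *)
Lemma hecke_trace n :
  (1 + rb * rc) *: t (1 : A n.+1) = (rb + rc) *: t (1 : A n.+2).
Proof.
apply/eqP; rewrite -subr_eq0 -(mt_quadratic _ _ _ mt) -quadratic_divE.
apply/eqP; set h := _ * _.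
(* The factorization is known only on images of the group algebra, so the element is lifted
   there. *)
pose i : 'I_n.+2.-1 := ord_max; pose g := ga_gen ringR (sigma i).
pose z := (g - ga_cst _ rb) * (g - ga_cst _ rc) * ga_gen ringR (sigma i)^-1%g.
have -> : h = tw_pi A n.+2 z.
  by rewrite /z !(rmorphM (tw_pi A _)) !(rmorphB (tw_pi A _)).
rewrite tu -(mt0 mt n.+1) -(rmorph0 (tw_pi A _)) tu; congr u.
rewrite [RHS](rmorph0 (tw_pi Hecke _)); apply: qproj_eq0.
apply/Defs.idealMr/ideal_gen.
exact: (@QuadraticRelator _ (braid_tower ringR) rb rc n.+2 i).
Qed.
End Ocneanu.

(** * The towers over R, and the morphisms psi_n *)

Section QuotientTower.
Variables (K : comPzRingType) (A : tower K) (P : forall n, A n -> Prop).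
Hypothesis P_incl : forall n z, @P n z -> ideal (@P n.+1) (tw_incl A n z).
Let Q := tquot P_incl.
Let pi n : {rmorphism A n -> Q n} := qproj (@P n).

Let pi_s n (i : 'I_n.-1) : @tw_s K Q n i = pi n (tw_s i). Proof. by []. Qed.
Let pi_sV n (i : 'I_n.-1) : @tw_sV K Q n i = pi n (tw_sV i). Proof. by []. Qed.
Let pi_cst n k : tw_cst Q n k = pi n (tw_cst A n k). Proof. by []. Qed.
Let piE := (pi_s, pi_sV, pi_cst).

(** A relator of the quotient is the image of the relator upstairs. This carries relations imposed
    at one stage of the construction to the next. *)
Lemma tquot_cubic a b c n z : cubic_relator (A := Q) (n := n) a b c z ->
  exists2 z', cubic_relator a b c z' & z = qproj (@P n) z'.
Proof.
case=> i; eexists; first exact: (CubicRelator A a b c i).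
by rewrite -/(pi n) !piE !rmorphM !rmorphB.
Qed.

Lemma tquot_bmwt x y n z : bmwt_relator (A := Q) (n := n) x y z ->
  exists2 z', bmwt_relator x y z' & z = qproj (@P n) z'.
Proof.
case=> i j ij; eexists; first exact: (BmwtRelator A x y ij).
rewrite -/(pi n) !piE !(rmorphD (pi n), rmorphB (pi n)).
by rewrite !(rmorphM (pi n), rmorphN (pi n)).
Qed.

Lemma tquot_bmw a xV eps n z : bmw_relator (A := Q) (n := n) a xV eps z ->
  exists2 z', bmw_relator a xV eps z' & z = qproj (@P n) z'.
Proof.
have eE i : bmw_e Q a xV eps i = pi n (bmw_e A a xV eps i).
  rewrite (rmorphB (pi n)) (rmorphM (pi n)) (rmorphD (pi n)).
  by rewrite !(rmorphM (pi n)).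
case=> i j i0 j1; eexists.
- exact: (BmwRelator A a xV eps i0 j1).
- by rewrite -/(pi n) (rmorphB (pi n)) !(rmorphM (pi n)) !eE !piE.
- exact: (BmwRelatorV A a xV eps i0 j1).
- by rewrite -/(pi n) (rmorphB (pi n)) !(rmorphM (pi n)) !eE !piE.
Qed.
End QuotientTower.

Lemma Halg_cubic (K : comPzRingType) (rho : {rmorphism ringR -> K}) n z :
  cubic_relator (A := Halg rho) (n := n) (rho ra) (rho rb) (rho rc) z -> z = 0.
Proof. by case/tquot_cubic=> z' Pz ->; apply/qproj_eq0/ideal_gen. Qed.

Lemma BMWt_cubic n z : cubic_relator (A := BMWt) (n := n) ra rb rc z -> z = 0.
Proof.
by case/tquot_cubic=> z' /(@Halg_cubic _ idfun) -> ->; exact: rmorph0.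
Qed.

Lemma BMWt_bmwt n z : bmwt_relator (A := BMWt) (n := n) rx ry z -> z = 0.
Proof. by case/tquot_bmwt=> z' Pz ->; apply/qproj_eq0/ideal_gen. Qed.

Lemma BMW_cubic e n z : cubic_relator (A := BMW e) (n := n)
  (R_Spm e ra) (R_Spm e rb) (R_Spm e rc) z -> z = 0.
Proof. by case/tquot_cubic=> z' /Halg_cubic -> ->; exact: rmorph0. Qed.

Lemma BMW_bmw e n z : bmw_relator (A := BMW e) (n := n)
  (R_Spm e ra) (S_Spm e rxV) ((-1) ^+ e) z -> z = 0.
Proof. by case/tquot_bmw=> z' Pz ->; apply/qproj_eq0/ideal_gen. Qed.

(** * Units of R and the relations of S^dag *)

Definition reV : ringR := locinv (a0 * b0 * c0).

Lemma reVK : reV * (ra * (rb * rc)) = 1.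
Proof.
rewrite mulrC mulrA ra.unlock rb.unlock rc.unlock -!rmorphM; exact: locin_inv.
Qed.

(** [ra * reV] is the inverse of y. *)
Lemma ryVK : (ra * reV) ^+ 2 * ry ^+ 2 = 1.
Proof.
by rewrite -exprMn mulrAC mulrC -[_ * ry]/(ra * (rb * rc)) reVK expr1n.
Qed.

Section Half.
Import mpoly.

(** The coefficients are rational. Inverting 2 serves both to separate S_+ from S_- and to invert
    the Vandermonde determinant. *)
Lemma rhalfK : exists h : ringR, h * 2%:R = 1.
Proof.
pose C := @mpolyC 3 rat.
have CK : C 2%:R^-1 * 2%:R = 1.
  by rewrite -(rmorph_nat C) -rmorphM mulVf ?rmorph1.
exists (locin (a0 * b0 * c0) (C 2%:R^-1)).
rewrite -[X in _ * X](rmorph_nat (locin (a0 * b0 * c0))) -rmorphM.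
rewrite -[RHS](rmorph1 (locin (a0 * b0 * c0))); exact: congr1 CK.
Qed.
End Half.

Lemma Sdag_ra2 : R_Sdag ra * R_Sdag ra = 1.
Proof.
apply/eqP; rewrite -subr_eq0 -[_ * _](rmorphM R_Sdag) -(rmorph1 R_Sdag).
by rewrite -(rmorphB R_Sdag) -expr2; apply/eqP/qproj_eq0/ideal_gen; left.
Qed.

Lemma Sdag_ry : R_Sdag ry = 1.
Proof.
apply/eqP; rewrite -subr_eq0 -(rmorph1 R_Sdag) -(rmorphB R_Sdag).
by apply/eqP/qproj_eq0/ideal_gen; right.
Qed.

(** * Characters taking one value on all generators *)

Section Character.
Variables (K L : comPzRingType) (A : tower K) (rho : {rmorphism K -> L}).
Variables (al : L) (f : forall n, {rmorphism A n -> L}).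
Hypothesis al2 : al * al = 1.
Hypothesis f_cst : forall n k, f n (tw_cst A n k) = rho k.
Hypothesis f_s : forall n (i : 'I_n.-1), f n (tw_s i) = al.

Lemma character_sV n (i : 'I_n.-1) : f n (tw_sV i) = al.
Proof.
rewrite -[LHS]mul1r -al2 -{2}(f_s i) -mulrA -rmorphM.
by rewrite tw_ssV rmorph1 mulr1.
Qed.

Lemma character_incl n (u : A n) : f n.+1 (tw_incl A n u) = f n u.
Proof.
elim/tw_ind: u => [|u v IHu IHv|k u IH|i u IH|i u IH].
- by rewrite !rmorph1.
- by rewrite !rmorphD IHu IHv.
- by rewrite !rmorphM IH tw_incl_cst !f_cst.
- by rewrite !rmorphM IH tw_incl_s !f_s.
- by rewrite !rmorphM IH tw_incl_sV !character_sV.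
Qed.

(** Adding a strand contributes one factor [al] from the power and one from s_n^{+-1}, and their
    product is 1. *)
Lemma character_markov :
  markov_trace (fun n (u : A n) => (al ^+ n * f n u : restr rho)).
Proof.
split=> n.
- by move=> k u v; rewrite rmorphD rmorphM f_cst mulrDr mulrCA.
- by move=> u v; rewrite !rmorphM [f _ u * _]mulrC.
- move=> u; rewrite rmorphM character_incl f_s exprS.
  by rewrite (mulrC (f _ u)) mulrACA al2 mul1r.
- move=> u; rewrite rmorphM character_incl character_sV exprS.
  by rewrite (mulrC (f _ u)) mulrACA al2 mul1r.
Qed.
End Character.

Lemma character_bmwt (K L : comPzRingType) (A : tower K) n
    (f : {rmorphism A n -> L}) (rho : {rmorphism K -> L}) (al : L) x y :
  (forall k, f (tw_cst A n k) = rho k) -> (forall i, f (tw_s i) = al) ->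
  (forall i, f (tw_sV i) = al) -> rho y = 1 ->
  forall z, bmwt_relator x y z -> f z = 0.
Proof.
move=> fc fs fsV y1 _ [i j _]; rewrite !(rmorphD f, rmorphB f).
rewrite !(rmorphM f, rmorphN f, rmorphXn f) !fc !fs !fsV.
(* At y = 1 the six terms are -al^3 + al^3 - al^3 - x al^2 + x al^2 + al^3, with x standing for its
   image. *)
by rewrite !(rmorphM rho, rmorphXn rho) y1; ring.
Qed.

Section Psi.
Variable n : nat.
Let al := R_Sdag ra.

(** The chosen representative does not matter: the defining relations preserve the parity of the
    word length, and [al] squares to 1. For the same reason a letter and its inverse both count as
    [al]. *)
Definition psi_braid (g : braid n) : Sdag := al ^+ size (bword g).

Lemma psi_braidE w : psi_braid (bclass w) = al ^+ size w.
Proof.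
have al2 : al ^+ 2 = 1 by exact: Sdag_ra2.
rewrite /psi_braid; move: (bclassK w); move: (bword _) => v.
elim=> {v w} // [u v w _ -> //|u u' v v' _ IHu _ IHv].
by rewrite !size_cat !exprD IHu IHv.
Qed.

Fact psi_braid1 : psi_braid 1%g = 1.
Proof. exact: psi_braidE [::]. Qed.
Fact psi_braidM g h : psi_braid (g * h)%g = psi_braid g * psi_braid h.
Proof.
by rewrite -[g]bwordK -[h]bwordK [(_ * _)%g]bmulE !psi_braidE size_cat exprD.
Qed.

Definition psi_grpalg : {rmorphism grpalg ringR (braid n) -> Sdag} :=
  ga_eval R_Sdag psi_braid1 psi_braidM.

Lemma psi_grpalg_s i : psi_grpalg (ga_gen ringR (sigma i)) = al.
Proof. by rewrite [LHS]ga_eval_mono rmorph1 mul1r psi_braidE. Qed.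
Lemma psi_grpalg_sV i : psi_grpalg (ga_gen ringR (sigma i)^-1%g) = al.
Proof.
by rewrite [LHS]ga_eval_mono rmorph1 mul1r [(_^-1)%g]binvE psi_braidE.
Qed.
Lemma psi_grpalg_cst k : psi_grpalg (ga_cst _ k) = R_Sdag k.
Proof. by rewrite [LHS]ga_eval_mono psi_braid1 mulr1. Qed.

Let psiE := (psi_grpalg_s, psi_grpalg_sV, psi_grpalg_cst).

Fact psi_cubic z :
  cubic_relator (A := braid_tower ringR) ra rb rc z -> psi_grpalg z = 0.
Proof.
case=> i; rewrite !(rmorphM psi_grpalg) !(rmorphB psi_grpalg) !psiE.
by rewrite subrr !mul0r.
Qed.

Definition psi_Halg : {rmorphism Halg (@idfun ringR) n -> Sdag} :=
  qlift psi_cubic.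

Lemma psi_Halg_s i : psi_Halg (tw_s i) = al.
Proof. by rewrite [LHS]qliftE psiE. Qed.
Lemma psi_Halg_sV i : psi_Halg (tw_sV i) = al.
Proof. by rewrite [LHS]qliftE psiE. Qed.
Lemma psi_Halg_cst k : psi_Halg (tw_cst _ n k) = R_Sdag k.
Proof. by rewrite [LHS]qliftE psiE. Qed.

Fact psi_bmwt z :
  bmwt_relator (A := Halg (@idfun ringR)) rx ry z -> psi_Halg z = 0.
Proof.
exact: (@character_bmwt _ _ _ _ psi_Halg R_Sdag al rx ry
  psi_Halg_cst psi_Halg_s psi_Halg_sV Sdag_ry).
Qed.

Definition psi_BMWt : {rmorphism BMWt n -> Sdag} := qlift psi_bmwt.

Lemma psi_BMWt_s i : psi_BMWt (tw_s i) = al.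
Proof. by rewrite [LHS]qliftE psi_Halg_s. Qed.
Lemma psi_BMWt_cst k : psi_BMWt (tw_cst _ n k) = R_Sdag k.
Proof. by rewrite [LHS]qliftE psi_Halg_cst. Qed.
End Psi.


Lemma tdag_markov (psi : forall n, {rmorphism BMWt n -> Sdag}) :
  psi_morphism psi -> markov_trace (tdag psi).
Proof. by case=> pc ps; exact: character_markov Sdag_ra2 pc ps. Qed.

Lemma psi_BMWtP : psi_morphism psi_BMWt.
Proof. by split=> n k; [exact: psi_BMWt_cst | exact: psi_BMWt_s]. Qed.

(** * Comparison over S^dag *)

Section BaseChange.
Variables (K L : comPzRingType) (rho : {rmorphism K -> L}).

Lemma ga_map_bincl n (h : grpalg K (braid n)) :
  ga_map rho idfun (ga_map idfun (@bincl n) h) =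
  ga_map idfun (@bincl n) (ga_map rho idfun h).
Proof.
elim/ga_ind: h => [|g h IHg IHh|k x]; first by rewrite !ga_map0.
  rewrite (ga_mapD idfun (@bincl n) g h) (ga_mapD rho idfun g h).
  rewrite (ga_mapD rho idfun (ga_map idfun (@bincl n) g)).
  rewrite (ga_mapD idfun (@bincl n) (ga_map rho idfun g) (ga_map rho idfun h)).
  congr (_ + _); [exact: IHg|exact: IHh].
by rewrite !ga_mapU.
Qed.

Variables (A : tower K) (B : tower L).
Variables (t : forall n, A n -> restr rho) (tau : forall n, B n -> L^o).
Hypothesis mtau : markov_trace tau.
Hypothesis t_tau : forall n (h : grpalg K (braid n.+1)),
  t (tw_pi A _ h) = tau (tw_pi B _ (ga_map rho idfun h)).

(** Every element of A_n lifts to the group algebra, where the Markov conditions transfer from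
    [tau]. This makes each component of the Kauffman pair a Markov trace over R. *)
Lemma base_change_markov : markov_trace t.
Proof.
have cstE n k : ga_map rho idfun (ga_cst (braid n) k) = ga_cst _ (rho k).
  exact: ga_map_mono.
have genE n (g : braid n) : ga_map rho idfun (ga_gen K g) = ga_gen L g.
  by rewrite [LHS]ga_map_mono rmorph1.
have mapM n (g h : grpalg K (braid n)) :
    ga_map rho idfun (g * h) = ga_map rho idfun g * ga_map rho idfun h.
  exact: rmorphM.
have tM n (g h : grpalg K (braid n.+1)) : t (tw_pi A _ g * tw_pi A _ h) =
    tau (tw_pi B _ (ga_map rho idfun g) * tw_pi B _ (ga_map rho idfun h)).
  rewrite -(rmorphM (tw_pi A _) g h) t_tau mapM.
  by rewrite (rmorphM (tw_pi B _) (ga_map rho idfun g)).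
split=> n.
- move=> k u v; have [h <-] := tw_surj u; have [h' <-] := tw_surj v.
  have -> : tw_cst A n.+1 k * tw_pi A _ h + tw_pi A _ h' =
      tw_pi A _ (ga_cst _ k * h + h').
    rewrite (rmorphD (tw_pi A _) (ga_cst _ k * h)).
    by rewrite (rmorphM (tw_pi A _) (ga_cst _ k)).
  rewrite !t_tau (ga_mapD rho idfun (ga_cst _ k * h)) mapM cstE.
  rewrite (rmorphD (tw_pi B _) (ga_cst _ (rho k) * ga_map rho idfun h)).
  rewrite (rmorphM (tw_pi B _) (ga_cst _ (rho k))).
  exact: (mt_linear mtau).
- move=> u v; have [h <-] := tw_surj u; have [h' <-] := tw_surj v.
  rewrite (tM _ h h') (tM _ h' h); exact: (mt_trace mtau).
- move=> u; have [h <-] := tw_surj u.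
  rewrite tw_inclE (tM _ _ (ga_gen K _)) t_tau genE ga_map_bincl -tw_inclE.
  exact: (mt_markov mtau).
- move=> u; have [h <-] := tw_surj u.
  rewrite tw_inclE (tM _ _ (ga_gen K _)) t_tau genE ga_map_bincl -tw_inclE.
  exact: (mt_markovV mtau).
Qed.
End BaseChange.

Section ExtensionOfScalars.
Variables (K L : comPzRingType) (rho : {rmorphism K -> L}) (M : lmodType K).

Lemma ext_inD (m n : M) : ext_in rho (m + n) = ext_in rho m + ext_in rho n.
Proof.
rewrite /ext_in -raddfD; apply/mproj_eq/submod_gen; exact: ext_relD.
Qed.

Lemma ext_inZ k (m : M) : ext_in rho (k *: m) = rho k *: ext_in rho m.
Proof.
rewrite /ext_in -linearZ; apply/mproj_eq/submod_gen; exact: ext_relZ.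
Qed.
End ExtensionOfScalars.

(** * Interpolation at three nodes *)

Section Vandermonde.
Variables (L : comPzRingType) (N : lmodType L) (n1 n2 n3 D : L) (p q r : N).
Hypothesis DK : D * ((n1 - n2) * (n1 - n3) * (n2 - n3)) = 1.

Lemma sum3AC (V : nmodType) (x1 x2 x3 y1 y2 y3 z1 z2 z3 : V) :
  (x1 + y1 + z1) + (x2 + y2 + z2) + (x3 + y3 + z3) =
  (x1 + x2 + x3) + (y1 + y2 + y3) + (z1 + z2 + z3).
Proof. by rewrite [LHS](AC (3*3*3) ((1*4*7)*(2*5*8)*(3*6*9))). Qed.

(** Lagrange interpolation: under the linear map 1, X, X^2 |-> p, q, r, the elements m1, m2, m3 are
    the images of the Lagrange polynomials of the nodes. *)
Lemma vandermonde3 : exists m1 m2 m3 : N, forall k l m : L,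
  k *: p + l *: q + m *: r =
  (k + l * n1 + m * n1 ^+ 2) *: m1 + (k + l * n2 + m * n2 ^+ 2) *: m2
  + (k + l * n3 + m * n3 ^+ 2) *: m3.
Proof.
(* The image of d (X - e) (X - f); [D] supplies the inverses of the node differences. *)
pose lag d e f := (d * (e * f)) *: p + (- d * (e + f)) *: q + d *: r.
exists (lag (D * (n2 - n3)) n2 n3), (lag (- D * (n1 - n3)) n1 n3).
exists (lag (D * (n1 - n2)) n1 n2) => k l m.
rewrite /lag !scalerDr !scalerA sum3AC -!scalerDl.
congr (_ *: _ + _ *: _ + _ *: _).
- by rewrite -[LHS]mulr1 -DK; ring.
- by rewrite -[LHS]mulr1 -DK; ring.
- by rewrite -[LHS]mulr1 -DK; ring.
Qed.
End Vandermonde.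

(** * Separation of Sbar by S_+ and S_-, and the values of the traces at 1 *)

Lemma ideal_mul (A : comPzRingType) (P Q : A -> Prop) g w :
  (forall z, P z -> ideal Q (g * z)) -> ideal P w -> ideal Q (g * w).
Proof.
move=> PQ; elim=> {w} [z /PQ||u v _ Qu _ Qv|u v _ Qv|u v _ Qu] //.
- by rewrite mulr0; exact: ideal0.
- by rewrite mulrDr; exact: Defs.idealD.
- by rewrite mulrCA; exact: Defs.idealMl.
- by rewrite mulrA; exact: Defs.idealMr.
Qed.

Definition S_Sbar : {rmorphism ringS -> Sbar} := qproj _.

Lemma S_SbarK (z : Sbar) : exists w, z = S_Sbar w.
Proof. by exists (qrepr z); rewrite [RHS]qreprK. Qed.

Lemma Sbar_SpmE e w : Sbar_Spm e (S_Sbar w) = S_Spm e w.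
Proof. exact: qmapE. Qed.

Lemma Sbar_SdagE w : Sbar_Sdag (S_Sbar w) = S_Sdag w.
Proof. exact: qmapE. Qed.

Lemma R_S_rx : R_S rx * rxV = 1.
Proof. exact: locin_inv. Qed.

(* If w lies in (a - y) and in (a + y), then (a + y) w and (a - y) w lie in
   (a^2 - y^2), hence so does their sum 2 a w; and 2 a is a unit. *)
Lemma Sbar_inj (z : Sbar) : (forall e, Sbar_Spm e z = 0) -> z = 0.
Proof.
have [w ->] := S_SbarK z => wE.
have killed (e : bool) : S_Sbar (R_S (ra + (-1) ^+ e * ry) * w) = 0.
  have /qproj_eq : S_Spm e w = S_Spm e 0 by rewrite -Sbar_SpmE wE rmorph0.
  rewrite subr0 => iw; apply: qproj_eq0; apply: ideal_mul iw => _ ->.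
  rewrite -(rmorphM R_S).
  have -> : (ra + (-1) ^+ e * ry) * (ra - (-1) ^+ e * ry) = ra ^+ 2 - ry ^+ 2.
    by case: e; rewrite ?expr1 ?expr0; ring.
  exact: ideal_gen.
have [h hK] := rhalfK.
have -> : w = R_S (h * reV * ry) * (R_S (ra + (-1) ^+ false * ry) * w
    + R_S (ra + (-1) ^+ true * ry) * w).
  rewrite -mulrDl -rmorphD mulrA -rmorphM.
  have -> : h * reV * ry * (ra + (-1) ^+ false * ry + (ra + (-1) ^+ true * ry))
      = (h * 2%:R) * (reV * (ra * ry)).
    by rewrite expr1 expr0; ring.
  by rewrite hK reVK mulr1 rmorph1 mul1r.
by rewrite rmorphM rmorphD !killed addr0 mulr0.
Qed.

Lemma BMWt_three (u : BMWt 3%N) : exists k l m : ringR,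
  forall (M : lmodType ringR) (t : forall n, BMWt n -> M), markov_trace t ->
    t _ u = k *: t 1%N 1 + l *: t 2%N 1 + m *: t 3%N 1.
Proof. exact: markov_trace_three reVK ryVK BMWt_cubic BMWt_bmwt u. Qed.

(** The value (1 + y)/x of t_2^H(1). *)
HB.lock Definition hecke_loop : ringS := R_S (1 + ry) * rxV.
(* [ra * reV] is 1/y, so the correction term is a/y, whose image in S_+ (resp.
   S_-) is 1 (resp. -1); this is how one element of S gives both t_2^+(1) and
   t_2^-(1). *)
HB.lock Definition kauffman_loop : ringS := hecke_loop - R_S (ra * (ra * reV)).

Lemma ocneanu_loop (tH : forall n, BMWt n -> restr R_S) : ocneanu_trace tH ->
  tH 2%N 1 = hecke_loop /\ tH 3%N 1 = hecke_loop ^+ 2.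
Proof.
case=> mt t1 [u tu].
have step n : R_S rx * tH n.+2 1 = R_S (1 + ry) * tH n.+1 1.
  exact: esym (hecke_trace mt tu n).
have solve (v w : ringS) : R_S rx * v = R_S (1 + ry) * w -> v = hecke_loop * w.
  move=> vw; rewrite -[LHS]mul1r -R_S_rx mulrAC vw hecke_loop.unlock; ring.
have t2 : tH 2%N 1 = hecke_loop.
  by rewrite (solve _ _ (step 0%N)) t1 mulr1.
by rewrite (solve _ _ (step 1%N)) t2.
Qed.

Lemma Spm_ra e : R_Spm e ra = (-1) ^+ e * R_Spm e ry.
Proof.
apply/eqP; rewrite -subr_eq0 -(rmorph_sign (R_Spm e)).
rewrite -(rmorphM (R_Spm e)) -(rmorphB (R_Spm e)).
by apply/eqP/qproj_eq0/ideal_gen.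
Qed.

Lemma Spm_kauffman_loop e : S_Spm e kauffman_loop =
  S_Spm e rxV * (R_Spm e rb * R_Spm e rc - (-1) ^+ e * R_Spm e rx + 1).
Proof.
have eVE : R_Spm e ra * R_Spm e (ra * reV) = (-1) ^+ e.
  rewrite Spm_ra -mulrA -(rmorphM (R_Spm e)).
  have -> : ry * (ra * reV) = reV * (ra * ry) by ring.
  by rewrite reVK rmorph1 mulr1.
have SR z : S_Spm e (R_S z) = R_Spm e z by [].
rewrite kauffman_loop.unlock hecke_loop.unlock.
rewrite (rmorphB (S_Spm e)) (rmorphM (S_Spm e)) !SR.
rewrite (rmorphM (R_Spm e) ra) eVE (rmorphD (R_Spm e)) (rmorph1 (R_Spm e)).
rewrite (rmorphM (R_Spm e) rb).
have xK : R_Spm e rx * S_Spm e rxV = 1.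
  by rewrite -SR -(rmorphM (S_Spm e)) R_S_rx rmorph1.
rewrite -[X in _ - X]mulr1 -xK; ring.
Qed.

(** Equality in Sbar is tested in S_+ and S_-. In each, the component is a Markov trace with values
    1, d, d^2 at 1, where d is the image of [kauffman_loop]. *)
Lemma kauffman_pair_loop (tK : forall n, BMWt n -> Sbar) u (k l m : ringR) :
  kauffman_pair_trace tK ->
  (forall (M : lmodType ringR) (t : forall n, BMWt n -> M), markov_trace t ->
    t _ u = k *: t 1%N 1 + l *: t 2%N 1 + m *: t 3%N 1) ->
  tK 3%N u =
  S_Sbar (R_S k + R_S l * kauffman_loop + R_S m * kauffman_loop ^+ 2).
Proof.
move=> [tpm tpmP tKE] klm.
apply/eqP; rewrite -subr_eq0; apply/eqP/Sbar_inj => e.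
have [mt t1 t2] := tpmP e.
pose t n (v : BMWt n) : restr (R_Spm e) := Sbar_Spm e (tK n v).
have tE n (h : grpalg ringR (braid n.+1)) :
    t n.+1 (tw_pi BMWt _ h) =
    tpm e n.+1 (tw_pi (BMW e) _ (ga_map (R_Spm e) idfun h)).
  exact: tKE.
have t_one n : t n.+1 1 = tpm e n.+1 1.
  by rewrite -[1 in LHS](rmorph1 (tw_pi BMWt _)) tE !rmorph1.
have SR z : S_Spm e (R_S z) = R_Spm e z by [].
have loopE : tpm e 2%N 1 = S_Spm e kauffman_loop.
  rewrite t2 Spm_kauffman_loop (rmorphM (S_Spm e)) mulrC SR.
  rewrite (rmorphD (R_Spm e)) (rmorphB (R_Spm e)) !(rmorphM (R_Spm e)).
  by rewrite rmorph_sign rmorph1.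
have xK : R_Spm e rx * S_Spm e rxV = 1.
  by rewrite -SR -(rmorphM (S_Spm e)) R_S_rx rmorph1.
have t3 : tpm e 3%N 1 = S_Spm e kauffman_loop ^+ 2.
  rewrite Spm_kauffman_loop; apply: (kauffman_three (a := R_Spm e ra)
    (b := R_Spm e rb) (c := R_Spm e rc) (A := BMW e) _ _ _ xK _ _ mt t1).
  - by rewrite Spm_ra (rmorphM (R_Spm e)).
  - by rewrite -expr2 sqrr_sign.
  - by rewrite -(rmorphD (R_Spm e)).
  - exact: BMW_cubic.
  - exact: BMW_bmw.
  - by rewrite loopE Spm_kauffman_loop.
rewrite rmorphB Sbar_SpmE -[Sbar_Spm e (tK _ _)]/(t 3%N u).
rewrite (klm _ _ (base_change_markov mt tE)) !t_one t1 loopE t3.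
rewrite [k *: _](mulr1 (R_Spm e k)) [l *: _]/(R_Spm e l * _).
rewrite [m *: _]/(R_Spm e m * _).
rewrite !(rmorphD (S_Spm e)) (rmorphM (S_Spm e) (R_S l)).
rewrite (rmorphM (S_Spm e) (R_S m)) (rmorphXn (S_Spm e)) !SR.
by rewrite subrr.
Qed.

(** * Invertibility of the node differences and the comparison of traces *)

Notation toV z := (Sdag_SdagV (S_Sdag z)).

Lemma SdagV_node_det : exists D : SdagV,
  D * ((toV hecke_loop - toV kauffman_loop) * (toV hecke_loop - R_SdagV ra)
       * (toV kauffman_loop - R_SdagV ra)) = 1.
Proof.
have [h hK] := rhalfK.
have hK' : R_SdagV h * 2%:R = 1.
  by rewrite -(rmorph_nat R_SdagV) -rmorphM hK rmorph1.
pose al := R_SdagV ra; pose X := R_SdagV rx; pose XV := toV rxV.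
have al2 : al * al = 1 by rewrite -(rmorphM Sdag_SdagV) Sdag_ra2 rmorph1.
have y1 : R_SdagV ry = 1 by rewrite [LHS](congr1 _ Sdag_ry) rmorph1.
have XK : X * XV = 1.
  by rewrite -[X]/(toV (R_S rx)) -!rmorphM R_S_rx !rmorph1.
have heckeE : toV hecke_loop = 2%:R * XV.
  rewrite hecke_loop.unlock !rmorphM -[toV (R_S _)]/(R_SdagV _).
  by rewrite rmorphD rmorph1 y1.
have kauffmanE : toV kauffman_loop = 2%:R * XV - al.
  rewrite kauffman_loop.unlock !rmorphB heckeE.
  rewrite -[toV (R_S _)]/(R_SdagV _) rmorphM.
  rewrite -/al (_ : R_SdagV (ra * reV) = 1) ?mulr1 //.
  rewrite -[LHS]mulr1 -{1}y1 -rmorphM.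
  have -> : ra * reV * ry = reV * (ra * ry) by ring.
  by rewrite reVK rmorph1.
(* a - x is inverted in the first of the two localizations, and its inverse is carried to the
   second. *)
have [g1 g1K] : exists g, (al - X) * g = 1.
  exists (locin _ (locinv (R_Sdag (ra - rx)))).
  rewrite -rmorphB; have := locin_inv (R_Sdag (ra - rx)).
  move/(congr1 (locin (Sdag_Sdag1 (R_Sdag (2 * ra - rx))))).
  by rewrite rmorphM rmorph1.
have [g2 g2K] : exists g, (2%:R * al - X) * g = 1.
  exists (locinv (Sdag_Sdag1 (R_Sdag (2 * ra - rx)))).
  rewrite -(rmorph_nat R_SdagV) -rmorphM -rmorphB; exact: locin_inv.
(* The determinant is 2 al^3 XV^2 (al - X) (2 al - X), and the inverse of al^3 is [al]. *)
exists (X * X * R_SdagV h * g1 * g2 * al).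
rewrite heckeE kauffmanE -/al.
have -> : 2%:R * XV - (2%:R * XV - al) = al by ring.
have -> : 2%:R * XV - al - al = 2%:R * XV * al * (al - X).
  transitivity (2%:R * XV * (al * al) - 2%:R * al * (X * XV)); last by ring.
  by rewrite al2 XK; ring.
have -> : 2%:R * XV - al = XV * al * (2%:R * al - X).
  transitivity (2%:R * XV * (al * al) - al * (X * XV)); last by ring.
  by rewrite al2 XK; ring.
transitivity ((X * XV) * (X * XV) * (R_SdagV h * 2%:R) * ((al - X) * g1)
  * ((2%:R * al - X) * g2) * (al * al) * (al * al)); first by ring.
by rewrite XK hK' g1K g2K al2 !mulr1.
Qed.

Theorem proposition5p11 :
  (exists psi : forall n, {rmorphism BMWt n -> Sdag},
     psi_morphism psi /\ markov_trace (tdag psi)) /\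
  (forall (M : lmodType ringR) (t : forall n, BMWt n -> M)
      (tH : forall n, BMWt n -> restr R_S) (tK : forall n, BMWt n -> Sbar)
      (psi : forall n, {rmorphism BMWt n -> Sdag}),
    markov_trace t -> ocneanu_trace tH -> kauffman_pair_trace tK ->
    psi_morphism psi ->
    exists m1 m2 m3 : extmod R_SdagV M, forall u : BMWt 3%N,
      ext_in R_SdagV (t 3%N u) =
        Sdag_SdagV (S_Sdag (tH 3%N u)) *: m1
        + Sdag_SdagV (Sbar_Sdag (tK 3%N u)) *: m2
        + Sdag_SdagV (tdag psi 3%N u) *: m3).
Proof.
split; first by exists psi_BMWt; split; [|apply: tdag_markov]; exact: psi_BMWtP.
move=> M t tH tK psi mt oH kK psiP.
have [D DK] := SdagV_node_det.
pose p := ext_in R_SdagV (t 1%N 1); pose q := ext_in R_SdagV (t 2%N 1).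
pose r := ext_in R_SdagV (t 3%N 1).
(* The coefficients depend only on the three values of t at 1, so they are fixed before u; only k,
   l, m vary with u. *)
have [m1 [m2 [m3 m123]]] := vandermonde3 p q r DK.
have al2 : R_SdagV ra * R_SdagV ra = 1.
  by rewrite -(rmorphM Sdag_SdagV) Sdag_ra2 rmorph1.
(* t^dag takes the values (a, a^2, a^3) = a (1, a, a^2), and a^-1 = a. *)
exists m1, m2, (R_SdagV ra *: m3) => u; have [k [l [m klm]]] := BMWt_three u.
have [H2 H3] := ocneanu_loop oH.
have [mtH H1 _] := oH.
have tHE : tH 3%N u = R_S k + R_S l * hecke_loop + R_S m * hecke_loop ^+ 2.
  rewrite (klm _ _ mtH) H1 H2 H3 [k *: _](mulr1 (R_S k)).
  by rewrite [l *: _]/(R_S l * _) [m *: _]/(R_S m * _).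
have tdE : tdag psi 3%N u = R_Sdag ra * (R_Sdag k + R_Sdag l * R_Sdag ra
    + R_Sdag m * R_Sdag ra ^+ 2).
  rewrite (klm _ _ (tdag_markov psiP)) /tdag !rmorph1 !mulr1.
  rewrite [k *: _]/(R_Sdag k * _) [l *: _]/(R_Sdag l * _).
  rewrite [m *: _]/(R_Sdag m * _).
  have factor (L : comPzRingType) (al k' l' m' : L) :
      k' * al ^+ 1 + l' * al ^+ 2 + m' * al ^+ 3 =
      al * (k' + l' * al + m' * al ^+ 2) by ring.
  exact: factor.
have extE : ext_in R_SdagV (t 3%N u) =
    R_SdagV k *: p + R_SdagV l *: q + R_SdagV m *: r.
  rewrite (klm _ _ mt) (ext_inD R_SdagV (_ + _)) (ext_inD R_SdagV (k *: _)).
  rewrite (ext_inZ R_SdagV k (t 1%N 1)) (ext_inZ R_SdagV l (t 2%N 1)).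
  by rewrite (ext_inZ R_SdagV m (t 3%N 1)).
have hE : toV (tH 3%N u) =
    R_SdagV k + R_SdagV l * toV hecke_loop + R_SdagV m * toV hecke_loop ^+ 2.
  by rewrite tHE !rmorphD !rmorphM.
have kE : Sdag_SdagV (Sbar_Sdag (tK 3%N u)) = R_SdagV k
    + R_SdagV l * toV kauffman_loop + R_SdagV m * toV kauffman_loop ^+ 2.
  by rewrite (kauffman_pair_loop kK klm) Sbar_SdagE !rmorphD !rmorphM.
have dE : Sdag_SdagV (tdag psi 3%N u) * R_SdagV ra =
    R_SdagV k + R_SdagV l * R_SdagV ra + R_SdagV m * R_SdagV ra ^+ 2.
  by rewrite tdE mulrC rmorphM mulrA al2 mul1r !rmorphD !rmorphM.
rewrite extE (m123 (R_SdagV k) (R_SdagV l) (R_SdagV m)) hE kE.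
by rewrite (scalerA (Sdag_SdagV _) (R_SdagV ra) m3) dE.
Qed.
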